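(* Let $A$ be a commutative subalgebra of $L(s',s)$. Let $\mathcal P$ denote the set of nonzero projections belonging to $A$ and let $\mathcal M$ be the set of minimal elements in $\mathcal P$ with respect to the order relation: for $P,Q\in\mathcal P$, $P\preceq Q\Leftrightarrow PQ=QP=P$. Then (i) $\mathcal M$ is an at most countable family of pairwise orthogonal projections belonging to $L(s',s)$ such that for every $P\in\mathcal P$ there exist $P'_1,\dots,P'_m\in\mathcal M$ with $P=P'_1+\cdots+P'_m$. (ii) If $A$ is also a closed ${}^*$-subalgebra of $L(s',s)$, then $\mathcal M$ is a Schauder basis in $A$.
   Context: $\mathbb N=\{1,2,\dots\}$, $\mathbb N_0=\mathbb N\cup\{0\}$. $s$ is the Fréchet space of complex sequences $\xi=(\xi_j)_{j\in\mathbb N}$ with $|\xi|_q:=(\sum_{j}|\xi_j|^2j^{2q})^{1/2}<\infty$ for all $q\in\mathbb N_0$, with the topology of the norms $(|\cdot|_q)_{q\in\mathbb N_0}$. $s'$ is the space of complex sequences with $|\xi|'_q:=(\sum_j|\xi_j|^2j^{-2q})^{1/2}<\infty$ for some $q\in\mathbb N_0$, with the inductive limit topology. Note $s\subset l_2\subset s'$ continuously. $L(s',s)$ is the Fréchet space of continuous linear operators $x:s'\to s$ with norms $\|x\|_q:=\sup_{|\xi|'_q\le1}|x\xi|_q$, $q\in\mathbb N_0$. It is an algebra under composition (using $s\subset s'$). Restriction to $l_2$ embeds $L(s',s)$ into the compact operators $K(l_2)$; via this embedding $L(s',s)$ is regarded as a subalgebra of $K(l_2)$, closed under the Hilbert space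 adjoint $x\mapsto x^*$, which is its (continuous) involution. A projection is a continuous orthogonal (self-adjoint) projection on $l_2$; $P,Q$ are orthogonal if $PQ=0$. A Schauder basis of a Fréchet space $E$ is a (finite or infinite) sequence $(e_n)$ such that every $x\in E$ has a unique expansion $x=\sum_n\mu_ne_n$, $\mu_n\in\mathbb C$, convergent in $E$; the at most countable set $\mathcal M$ is regarded as a sequence by enumerating it. *)

(* Defs.v *)
From HB Require Import structures.
From mathcomp Require Import all_boot all_order all_algebra.
From mathcomp Require Import all_classical all_reals all_analysis.
From mathcomp Require Import complex ring lra.

Set Implicit Arguments.
Unset Strict Implicit.
Unset Printing Implicit Defensive.

Import Order.TTheory GRing.Theory Num.Theory.
Import numFieldNormedType.Exports.

Local Open Scope classical_set_scope.
Local Open Scope ring_scope.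

(* The topology defined by a sequence of (extended real valued) norms [p]: the
   finite intersections of balls form a base of neighbourhoods. *)
Section NormTopology.
Context {R : realType} {V : zmodType}.
Variable p : nat -> V -> \bar R.

Definition norm_ball (n : nat) (e : R) : set V :=
  [set y | forall k, (k <= n)%N -> (p k y < e%:E)%E].

Definition norm_open : set_system V := [set U | forall x, U x ->
  exists n (e : R), 0 < e /\ forall y, norm_ball n e y -> U (x + y)].

Lemma norm_openT : norm_open setT.
Proof. by move=> x _; exists 0%N, 1. Qed.

Lemma norm_openI : setI_closed norm_open.
Proof.
move=> U W oU oW x [/oU [n1 [e1 [e10 h1]]] /oW [n2 [e2 [e20 h2]]]].
exists (maxn n1 n2), (Num.min e1 e2); split; first by rewrite lt_min e10.
move=> y yb; split; [apply: h1|apply: h2] => k kn.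
  apply: lt_le_trans (yb k _) _; first by rewrite leq_max kn.
  by rewrite lee_fin ge_min lexx.
apply: lt_le_trans (yb k _) _; first by rewrite leq_max kn orbT.
by rewrite lee_fin ge_min lexx orbT.
Qed.

Lemma norm_open_bigU (I : Type) (f : I -> set V) :
  (forall i, norm_open (f i)) -> norm_open (\bigcup_i f i).
Proof.
move=> fo x [i _ fix_]; have [n [e [e0 h]]] := fo i x fix_.
by exists n, e; split => // y /h fy; exists i.
Qed.

Lemma norm_ball_openN (p0 : forall k, p k 0 = 0%E)
  (pD : forall k e x y, 0 < e -> (p k x < (e / 2)%:E)%E ->
     (p k y < (e / 2)%:E)%E -> (p k (x + y)%R < e%:E)%E) n e : 0 < e ->
  exists U, [/\ norm_open U, U 0 & U `<=` norm_ball n e].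
Proof.
move=> e0; exists [set x | exists m (d : R),
  0 < d /\ forall y, norm_ball m d y -> norm_ball n e (x + y)]; split.
- move=> x [m [d [d0 h]]]; exists m, (d / 2); split; first by rewrite divr_gt0.
  move=> y yb; exists m, (d / 2); split; first by rewrite divr_gt0.
  move=> z zb; rewrite -addrA; apply: h => k km.
  by apply: pD => //; [apply: yb|apply: zb].
- by exists n, e; split => // y; rewrite add0r.
- move=> x [m [d [d0 h]]]; rewrite -[x]addr0; apply: h => k _.
  by rewrite p0 lte_fin.
Qed.

End NormTopology.

Section Sequences.
Context {R : realType}.
Implicit Types (w : nat -> R) (x y : nat -> R[i]).

Definition weighted_norm w x : \bar R :=
  sqrte (\sum_(0 <= j <oo) (w j * ComplexField.Normc.normc (x j) ^+ 2)%:E)%E.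

(* Positions start at 0: the [j]-th entry is the coordinate $\xi_{j+1}$. *)
Definition norm_s (q : nat) : (nat -> R[i]) -> \bar R :=
  weighted_norm (fun j => j.+1%:R ^+ (2 * q)).

Definition norm_sdual (q : nat) : (nat -> R[i]) -> \bar R :=
  weighted_norm (fun j => j.+1%:R ^- (2 * q)).

Lemma norm_sdual0 : norm_sdual 0 = norm_s 0.
Proof.
by congr weighted_norm; apply/funext => j; rewrite muln0 !expr0 invr1.
Qed.

Lemma weighted_norm0 w : weighted_norm w 0 = 0%E.
Proof.
rewrite /weighted_norm eseries0 ?sqrte0// => j _ _.
by rewrite ComplexField.Normc.normc0 expr0n mulr0.
Qed.

Section Weight.
Variable w : nat -> R.
Hypothesis w0 : forall j, 0 <= w j.

Local Notation sq x := (\sum_(0 <= j <oo)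
  (w j * ComplexField.Normc.normc (x j) ^+ 2)%:E)%E.

Lemma weighted_term_ge0 x j :
  (0 <= (w j * ComplexField.Normc.normc (x j) ^+ 2)%:E)%E.
Proof. by rewrite lee_fin mulr_ge0// sqr_ge0. Qed.

Lemma weighted_sum_ge0 x : (0 <= sq x)%E.
Proof. by apply: nneseries_ge0 => j _ _; exact: weighted_term_ge0. Qed.

Lemma weighted_norm_lt x (e : R) : 0 < e ->
  (weighted_norm w x < e%:E)%E = (sq x < (e ^+ 2)%:E)%E.
Proof.
move=> e0; rewrite -[in LHS](ger0_norm (ltW e0)).
have -> : `|e|%:E = sqrte ((e ^+ 2)%:E) by rewrite /= sqrtr_sqr.
by rewrite /weighted_norm !ltNge lee_sqrt// weighted_sum_ge0.
Qed.

Lemma weighted_normD (e : R) x y : 0 < e ->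
  (weighted_norm w x < (e / 2)%:E)%E -> (weighted_norm w y < (e / 2)%:E)%E ->
  (weighted_norm w (x + y)%R < e%:E)%E.
Proof.
move=> e0; have e20 : 0 < e / 2 by rewrite divr_gt0.
rewrite !weighted_norm_lt// => xe ye.
apply: (@le_lt_trans _ _ (2%:E * sq x + 2%:E * sq y)%E).
  rewrite -!nneseriesZl//; try by move=> j _; exact: weighted_term_ge0.
  rewrite -nneseriesD; first last.
  - by move=> *; rewrite mule_ge0// weighted_term_ge0.
  - by move=> *; rewrite mule_ge0// weighted_term_ge0.
  apply: lee_nneseries => [*|j _]; first exact: weighted_term_ge0.
  rewrite -!EFinM -EFinD lee_fin.
  have h := le_normcD (x j) (y j).
  have h1 : 0 <= ComplexField.Normc.normc ((x + y) j).
    by case: ((x + y) j) => ? ?; exact: sqrtr_ge0.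
  rewrite -[(x + y) j]/(x j + y j) in h1 *.
  move: (w0 j) h h1; set a := ComplexField.Normc.normc _.
  set b := ComplexField.Normc.normc _; set c := ComplexField.Normc.normc _.
  move=> wj h h1.
  rewrite [leRHS](_ : _ = w j * (2 * (b ^+ 2 + c ^+ 2))); last by ring.
  apply: ler_wpM2l => //.
  have h2 : a ^+ 2 <= (b + c) ^+ 2.
    by rewrite ler_sqr ?nnegrE// (le_trans h1).
  by have := sqr_ge0 (b - c); rewrite sqrrB sqrrD in h2 *; lra.
rewrite -muleDr//; last by rewrite ge0_adde_def// inE weighted_sum_ge0.
rewrite [ltRHS](_ : _ = 2%:E * ((e / 2) ^+ 2 + (e / 2) ^+ 2)%:E)%E.
  by rewrite lte_pmul2l// EFinD lteD.
by rewrite -EFinM; congr EFin; field.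
Qed.

Lemma weighted_normZ (e : R) (a : R[i]) x : 0 < e ->
  (weighted_norm w x < (e / (ComplexField.Normc.normc a + 1))%:E)%E ->
  (weighted_norm w (a *: x)%R < e%:E)%E.
Proof.
have a0 : 0 <= ComplexField.Normc.normc a by case: a => ? ?; exact: sqrtr_ge0.
move=> e0; rewrite !weighted_norm_lt ?divr_gt0 ?ltr_wpDl//.
set na := ComplexField.Normc.normc a in a0 *.
move=> h; apply: (@le_lt_trans _ _ (((na + 1) ^+ 2)%:E * sq x)%E).
  rewrite -nneseriesZl; last by move=> j _; exact: weighted_term_ge0.
  apply: lee_nneseries => [*|j _]; first exact: weighted_term_ge0.
  rewrite -[(a *: x) j]/(a * x j) ComplexField.Normc.normcM -/na -EFinM lee_fin.
  rewrite exprMn mulrCA ler_wpM2r//.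
    by rewrite mulr_ge0// sqr_ge0.
  by rewrite ler_sqr ?nnegrE ?addr_ge0// lerDl.
have n0 : 0 < na + 1 by rewrite ltr_wpDl.
rewrite [ltRHS](_ : _ = (((na + 1) ^+ 2)%:E * ((e / (na + 1)) ^+ 2)%:E)%E).
  by rewrite lte_pmul2l// lte_fin exprn_gt0.
by rewrite -EFinM; congr EFin; field; rewrite gt_eqF.
Qed.

Lemma weighted_norm_finP x : (weighted_norm w x < +oo)%E <->
  exists2 e : R, 0 < e & (weighted_norm w x < e%:E)%E.
Proof.
split=> [h|[e _ h]]; last by rewrite (lt_trans h) ?ltry.
have h0 : (0 <= weighted_norm w x)%E by exact: sqrte_ge0.
exists (fine (weighted_norm w x) + 1); first by rewrite ltr_wpDl ?fine_ge0.
by rewrite EFinD fineK ?ge0_fin_numE// lteDl ?ge0_fin_numE// lte_fin.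
Qed.

Lemma weighted_norm_finZD (a : R[i]) x y : (weighted_norm w x < +oo)%E ->
  (weighted_norm w y < +oo)%E -> (weighted_norm w (a *: x + y)%R < +oo)%E.
Proof.
move=> /weighted_norm_finP[e1 e10 h1] /weighted_norm_finP[e2 e20 h2].
have a0 : 0 <= ComplexField.Normc.normc a by case: a => ? ?; exact: sqrtr_ge0.
set na := ComplexField.Normc.normc a in a0 *.
have n0 : 0 < na + 1 by rewrite ltr_wpDl.
pose m := (na + 1) * e1 + e2.
have m0 : 0 < m by rewrite addr_gt0// mulr_gt0.
apply/weighted_norm_finP; exists (m * 2); first by rewrite mulr_gt0.
apply: weighted_normD; rewrite ?mulr_gt0// mulfK//.
  apply: weighted_normZ => //; rewrite (lt_le_trans h1)// lee_fin.
  by rewrite ler_pdivlMr// mulrC lerDl ltW.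
by rewrite (lt_le_trans h2)// lee_fin lerDr ltW// mulr_gt0.
Qed.

End Weight.

Lemma weight_s_ge0 q j : 0 <= j.+1%:R ^+ (2 * q) :> R.
Proof. exact: exprn_ge0. Qed.

Lemma weight_sdual_ge0 q j : 0 <= j.+1%:R ^- (2 * q) :> R.
Proof. by rewrite invr_ge0 exprn_ge0. Qed.

Lemma le_weighted_norm w1 w2 x : (forall j, 0 <= w1 j) ->
  (forall j, w1 j <= w2 j) -> (weighted_norm w1 x <= weighted_norm w2 x)%E.
Proof.
move=> w10 w12; rewrite /weighted_norm lee_sqrt.
  apply: lee_nneseries => [*|j _]; first exact: weighted_term_ge0.
  by rewrite lee_fin ler_wpM2r ?sqr_ge0.
by apply: weighted_sum_ge0 => j; exact: le_trans (w12 j).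
Qed.

Lemma le_norm_sdual q r x : (q <= r)%N -> (norm_sdual r x <= norm_sdual q x)%E.
Proof.
move=> qr; apply: le_weighted_norm => [|j]; first exact: weight_sdual_ge0.
rewrite lef_pV2 ?posrE ?exprn_gt0// ler_weXn2l ?leq_mul2l//.
by rewrite ler1n.
Qed.

Definition in_s : {pred nat -> R[i]} :=
  [pred x | `[< forall q, (norm_s q x < +oo)%E >]].
Definition in_l2 : {pred nat -> R[i]} := [pred x | (norm_s 0 x < +oo)%E].
Definition in_sdual : {pred nat -> R[i]} :=
  [pred x | `[< exists q, (norm_sdual q x < +oo)%E >]].

Lemma in_s_submod_closed : submod_closed in_s.
Proof.
split=> [|a x y /asboolP hx /asboolP hy]; apply/asboolP => q.
  by rewrite /norm_s weighted_norm0 ltry.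
by apply: weighted_norm_finZD => //; [exact: hx|exact: hy].
Qed.

Lemma in_l2_submod_closed : submod_closed in_l2.
Proof.
split=> [|a x y hx hy]; rewrite inE.
  by rewrite /norm_s weighted_norm0 ltry.
exact: weighted_norm_finZD.
Qed.

Lemma in_sdual_submod_closed : submod_closed in_sdual.
Proof.
split=> [|a x y /asboolP[q hx] /asboolP[r hy]]; apply/asboolP.
  by exists 0%N; rewrite /norm_sdual weighted_norm0 ltry.
exists (maxn q r); apply: weighted_norm_finZD.
- exact: weight_sdual_ge0.
- by rewrite (le_lt_trans _ hx)// le_norm_sdual// leq_maxl.
- by rewrite (le_lt_trans _ hy)// le_norm_sdual// leq_maxr.
Qed.

HB.instance Definition _ :=
  GRing.isSubmodClosed.Build R[i] (nat -> R[i]) in_s in_s_submod_closed.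
HB.instance Definition _ :=
  GRing.isSubmodClosed.Build R[i] (nat -> R[i]) in_l2 in_l2_submod_closed.
HB.instance Definition _ :=
  GRing.isSubmodClosed.Build R[i] (nat -> R[i]) in_sdual in_sdual_submod_closed.

End Sequences.

Record s (R : realType) := S { s_val :> nat -> R[i]; s_valP : s_val \in in_s }.
Record l2 (R : realType) :=
  L2 { l2_val :> nat -> R[i]; l2_valP : l2_val \in in_l2 }.
Record sdual (R : realType) :=
  Sdual { sdual_val :> nat -> R[i]; sdual_valP : sdual_val \in in_sdual }.

HB.instance Definition _ (R : realType) := [isSub for @s_val R].
HB.instance Definition _ (R : realType) := [Choice of s R by <:].
HB.instance Definition _ (R : realType) :=
  [SubChoice_isSubLmodule of s R by <:].

HB.instance Definition _ (R : realType) := [isSub for @l2_val R].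
HB.instance Definition _ (R : realType) := [Choice of l2 R by <:].
HB.instance Definition _ (R : realType) :=
  [SubChoice_isSubLmodule of l2 R by <:].

HB.instance Definition _ (R : realType) := [isSub for @sdual_val R].
HB.instance Definition _ (R : realType) := [Choice of sdual R by <:].
HB.instance Definition _ (R : realType) :=
  [SubChoice_isSubLmodule of sdual R by <:].

HB.instance Definition _ (R : realType) :=
  let p := fun q (x : s R) => norm_s q x in
  isOpenTopological.Build (s R)
    (norm_openT p) (@norm_openI _ _ p) (@norm_open_bigU _ _ p).

HB.instance Definition _ (R : realType) :=
  let p := fun (_ : nat) (x : l2 R) => norm_s 0 x in
  isOpenTopological.Build (l2 R)
    (norm_openT p) (@norm_openI _ _ p) (@norm_open_bigU _ _ p).

(* The locally convex inductive limit topology of the Hilbert spaces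
   $\{|\cdot|'_q<\infty\}$: a base of neighbourhoods of 0 consists of the
   absolutely convex sets meeting each of these spaces in a neighbourhood of 0. *)
Section InductiveLimit.
Context {R : realType}.

Definition sdual_nbhs0 (V : set (sdual R)) : Prop :=
  (forall (a b : R[i]) x y, `|a| + `|b| <= 1 -> V x -> V y ->
     V (a *: x + b *: y)) /\
  (forall q : nat, exists d : R, 0 < d /\
     forall x : sdual R, (norm_sdual q x < d%:E)%E -> V x).

Definition sdual_open : set_system (sdual R) :=
  [set U | forall x, U x ->
     exists2 V, sdual_nbhs0 V & forall y, V y -> U (x + y)].

Lemma sdual_nbhs0T : sdual_nbhs0 setT.
Proof. by split => // q; exists 1. Qed.

Lemma sdual_nbhs0I V W : sdual_nbhs0 V -> sdual_nbhs0 W -> sdual_nbhs0 (V `&` W).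
Proof.
move=> [V1 V2] [W1 W2]; split=> [a b x y ab [? ?] [? ?]|q].
  by split; [apply: V1|apply: W1].
have [d1 [d10 h1]] := V2 q; have [d2 [d20 h2]] := W2 q.
exists (Num.min d1 d2); split=> [|x xd]; first by rewrite lt_min d10.
split; [apply: h1|apply: h2]; rewrite (lt_le_trans xd)// lee_fin ge_min lexx//.
by rewrite orbT.
Qed.

Lemma sdual_openT : sdual_open setT.
Proof. by move=> x _; exists setT => //; exact: sdual_nbhs0T. Qed.

Lemma sdual_openI : setI_closed sdual_open.
Proof.
move=> U W oU oW x [/oU [V1 hV1 h1] /oW [V2 hV2 h2]].
exists (V1 `&` V2); first exact: sdual_nbhs0I.
by move=> y [/h1 ? /h2].
Qed.

Lemma sdual_open_bigU (I : Type) (f : I -> set (sdual R)) :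
  (forall i, sdual_open (f i)) -> sdual_open (\bigcup_i f i).
Proof.
move=> fo x [i _ fix_]; have [V hV h] := fo i x fix_.
by exists V => // y /h fy; exists i.
Qed.

HB.instance Definition _ := isOpenTopological.Build (sdual R)
  sdual_openT sdual_openI sdual_open_bigU.

Lemma sdual_nbhs0_half V : sdual_nbhs0 V ->
  sdual_nbhs0 [set x | V (2 *: x)].
Proof.
move=> [V1 V2]; split=> [a b x y ab /= Vx Vy|q].
  have := V1 a b _ _ ab Vx Vy; rewrite !scalerDr !scalerA.
  by rewrite (mulrC a) (mulrC b).
have [d [d0 h]] := V2 q.
exists (d / (ComplexField.Normc.normc 2 + 1)); split.
  rewrite divr_gt0// ltr_wpDl//; exact: sqrtr_ge0.
move=> x xd; apply: h.
rewrite -[sdual_val (2 *: x)]/(2 *: sdual_val x).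
by apply: weighted_normZ => //; exact: weight_sdual_ge0.
Qed.

Lemma sdual_nbhs0_mid V x y : sdual_nbhs0 V -> V (2 *: x) -> V (2 *: y) ->
  V (x + y).
Proof.
move=> [V1 _] Vx Vy.
have := V1 2^-1 2^-1 _ _ _ Vx Vy; rewrite !scalerA mulVf ?pnatr_eq0// !scale1r.
by apply; rewrite ger0_norm ?invr_ge0 ?ler0n// -mulr2n -[_ *+ 2]mulr_natr mulVf ?pnatr_eq0.
Qed.

Lemma sdual_nbhs0_open V : sdual_nbhs0 V ->
  exists U, [/\ sdual_open U, U 0 & U `<=` V].
Proof.
move=> hV; exists [set x | exists2 W, sdual_nbhs0 W & forall y, W y -> V (x + y)].
split.
- move=> x [W hW h]; exists [set x | W (2 *: x)]; first exact: sdual_nbhs0_half.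
  move=> y /= Wy; exists [set x | W (2 *: x)]; first exact: sdual_nbhs0_half.
  move=> z /= Wz; rewrite -addrA; apply: h; exact: sdual_nbhs0_mid.
- by exists V => // y; rewrite add0r.
- move=> x [W [_ W2] h]; rewrite -[x]addr0; apply: h.
  have [d [d0]] := W2 0%N; apply.
  by rewrite [norm_sdual _ _]weighted_norm0 lte_fin.
Qed.

End InductiveLimit.

Section Inclusions.
Context {R : realType}.

Lemma in_s_l2 : {subset @in_s R <= in_l2}.
Proof. by move=> x /asboolP; exact. Qed.

Lemma in_l2_sdual : {subset @in_l2 R <= in_sdual}.
Proof. by move=> x xl; apply/asboolP; exists 0%N; rewrite norm_sdual0. Qed.

Definition s_to_l2 (x : s R) : l2 R := L2 (in_s_l2 (s_valP x)).
Definition l2_to_sdual (x : l2 R) : sdual R := Sdual (in_l2_sdual (l2_valP x)).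
Definition s_to_sdual (x : s R) : sdual R := l2_to_sdual (s_to_l2 x).

End Inclusions.

Section SmoothOperators.
Context {R : realType}.

Definition is_smooth_op : {pred sdual R -> s R} :=
  [pred x : sdual R -> s R | `[< linear x /\ continuous x >]].

Lemma linear_continuousP (f : sdual R -> s R) : linear f ->
  continuous f <-> forall n (e : R), 0 < e ->
    exists2 V, sdual_nbhs0 V &
      forall v, V v -> norm_ball (fun q (x : s R) => norm_s q x) n e (f v).
Proof.
move=> lf; pose p q (x : s R) := norm_s q x.
have fD x y : f (x + y) = f x + f y by have := lf 1 x y; rewrite !scale1r.
have f0 : f 0 = 0 by apply: (@addrI _ (f 0)); rewrite -fD !addr0.
split=> [cf n e e0|H].
  have [||U [oU U0 Ub]] := @norm_ball_openN _ _ p _ _ n e e0.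
  - by move=> k; exact: weighted_norm0.
  - by move=> k d x y d0; apply: weighted_normD => //; exact: weight_s_ge0.
  have oU' : open U by exact: oU.
  have : sdual_open (f @^-1` U).
    by have /continuousP /(_ _ oU') := cf.
  move=> /(_ 0); rewrite /preimage /= f0 => /(_ U0)[V hV h].
  by exists V => // v /h /=; rewrite add0r => /Ub.
apply/continuousP => U oU.
suff : sdual_open (f @^-1` U) by [].
move=> x /= fxU.
have : norm_open p U by exact: oU.
move=> /(_ _ fxU)[n [e [e0 h]]]; have [V hV hf] := H n e e0.
by exists V => // y /hf /h; rewrite fD.
Qed.

Lemma smooth_op_submod_closed : submod_closed is_smooth_op.
Proof.
split=> [|a f g /asboolP[lf cf] /asboolP[lg cg]]; apply/asboolP.
  have l0 : linear (0 : sdual R -> s R) by move=> b x y; rewrite scaler0 addr0.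
  split=> //; apply/(linear_continuousP l0) => n e e0.
  exists setT; first exact: sdual_nbhs0T.
  by move=> v _ k _; rewrite [norm_s _ _]weighted_norm0 lte_fin.
have lfg : linear (a *: f + g).
  move=> b x y.
  rewrite -[LHS]/(a *: f (b *: x + y) + g (b *: x + y)) lf lg.
  rewrite -[RHS]/(b *: (a *: f x + g x) + (a *: f y + g y)).
  by rewrite !scalerDr !scalerA (mulrC a) addrACA.
split=> //; apply/(linear_continuousP lfg) => n e e0.
have a0 : 0 < ComplexField.Normc.normc a + 1.
  by rewrite ltr_wpDl//; case: (a) => ? ?; exact: sqrtr_ge0.
have e20 : 0 < e / 2 by rewrite divr_gt0.
have [V hV hf] := (linear_continuousP lf).1 cf n _ (divr_gt0 e20 a0).
have [W hW hg] := (linear_continuousP lg).1 cg n _ e20.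
exists (V `&` W); first exact: sdual_nbhs0I.
move=> v [/hf fv /hg gv] k kn.
rewrite -[s_val _]/(a *: s_val (f v) + s_val (g v)).
apply: (weighted_normD (weight_s_ge0 k)) => //.
  by apply: (weighted_normZ (weight_s_ge0 k)) => //; exact: fv.
exact: gv.
Qed.

HB.instance Definition _ := GRing.isSubmodClosed.Build R[i] (sdual R -> s R)
  is_smooth_op smooth_op_submod_closed.

End SmoothOperators.

(* The elements of $L(s',s)$. *)
Record smooth_op (R : realType) := SmoothOp {
  smooth_op_fun :> sdual R -> s R;
  smooth_opP : smooth_op_fun \in is_smooth_op }.

HB.instance Definition _ (R : realType) := [isSub for @smooth_op_fun R].
HB.instance Definition _ (R : realType) := [Choice of smooth_op R by <:].
HB.instance Definition _ (R : realType) :=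
  [SubChoice_isSubLmodule of smooth_op R by <:].

Definition op_norm {R : realType} (q : nat) (x : smooth_op R) : \bar R :=
  ereal_sup
    [set norm_s q (x xi) | xi in [set xi : sdual R | (norm_sdual q xi <= 1)%E]].

HB.instance Definition _ (R : realType) :=
  isOpenTopological.Build (smooth_op R) (norm_openT (@op_norm R))
    (@norm_openI _ _ (@op_norm R)) (@norm_open_bigU _ _ (@op_norm R)).

Section Algebra.
Context {R : realType}.
Implicit Types (x y P Q : smooth_op R) (A : set (smooth_op R)).

Lemma smooth_op_comp_subproof x y : x \o s_to_sdual \o y \in is_smooth_op.
Proof.
have /asboolP[lx cx] := smooth_opP x; have /asboolP[ly cy] := smooth_opP y.
apply/asboolP; split.
  move=> a u v /=; rewrite ly -lx; congr (smooth_op_fun x _); exact: val_inj.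
move=> u; apply: continuous_comp; first exact: cy.
apply: continuous_comp; last exact: cx.
move: {u}(y u); apply/continuousP => U oU.
suff : norm_open (fun q (x : s R) => norm_s q x) (s_to_sdual @^-1` U) by [].
have {}oU : sdual_open U by [].
move=> z /= /oU[V [_ V2] h]; have [d [d0 hd]] := V2 0%N.
exists 0%N, d; split=> // v /(_ 0%N isT) vd.
rewrite (_ : s_to_sdual _ = s_to_sdual z + s_to_sdual v); last exact: val_inj.
by apply: h; apply: hd; rewrite norm_sdual0.
Qed.

Definition smooth_op_comp x y : smooth_op R :=
  SmoothOp (smooth_op_comp_subproof x y).

(* The embedding of $L(s',s)$ into the operators on $l_2$, through which
   projections and adjoints are understood. *)
Definition l2_restr x : l2 R -> l2 R := s_to_l2 \o x \o l2_to_sdual.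

Definition l2_inner (xi eta : l2 R) : R[i] :=
  limn (series (fun j => xi j * conjc (eta j) : R[i]^o)).

Definition l2_adjoint (f g : l2 R -> l2 R) : Prop :=
  forall xi eta, l2_inner (f xi) eta = l2_inner xi (g eta).

Definition l2_projection (f : l2 R -> l2 R) : Prop :=
  [/\ linear f, continuous f, f \o f = f & l2_adjoint f f].

(* Subalgebras are not required to have a unit; $L(s',s)$ has none. *)
Definition subalgebra A : Prop :=
  submod_closed [in A] /\
  forall x y, A x -> A y -> A (smooth_op_comp x y).

Definition commutative_set A : Prop :=
  forall x y, A x -> A y -> smooth_op_comp x y = smooth_op_comp y x.

Definition star_closed A : Prop :=
  forall x, A x -> exists2 y, A y & l2_adjoint (l2_restr x) (l2_restr y).

Definition projections A : set (smooth_op R) :=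
  [set P | [/\ A P, P != 0 & l2_projection (l2_restr P)]].

Definition proj_le P Q : Prop :=
  smooth_op_comp P Q = P /\ smooth_op_comp Q P = P.

Definition minimal_projections A : set (smooth_op R) :=
  [set P | projections A P /\
    forall Q, projections A Q -> proj_le Q P -> Q = P].

End Algebra.

Section SchauderBasis.
Context {R : realType} {V : preTopologicalLmodType R[i]}.
Implicit Types E M : set V.

Definition finite_schauder_basis E n (e : 'I_n -> V) : Prop :=
  (forall i, E (e i)) /\
  forall x, E x -> exists! mu : 'I_n -> R[i], x = \sum_(i < n) mu i *: e i.

Definition infinite_schauder_basis E (e : nat -> V) : Prop :=
  (forall n, E (e n)) /\
  forall x, E x -> exists! mu : nat -> R[i],
    series (fun n => mu n *: e n) @ \oo --> x.

(* An at most countable set is a Schauder basis when all its enumerations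
   without repetition are. *)
Definition schauder_basis E M : Prop :=
  [/\ countable M,
      forall n (e : 'I_n -> V), set_bij setT M e -> finite_schauder_basis E e &
      forall e : nat -> V, set_bij setT M e -> infinite_schauder_basis E e].

End SchauderBasis.

(* Main.v *)
Require Import Defs.
From HB Require Import structures.
From mathcomp Require Import all_boot all_order all_algebra.
From mathcomp Require Import all_classical all_reals all_analysis.
From mathcomp Require Import complex ring lra zify.

Import Order.TTheory GRing.Theory Num.Theory.
Import numFieldNormedType.Exports.

Local Open Scope classical_set_scope.
Local Open Scope ring_scope.

Set Implicit Arguments.
Unset Strict Implicit.
Unset Printing Implicit Defensive.


(* A projection in L(s',s) is Hilbert-Schmidt, its squared Hilbert-Schmidt norm
   is at least 1 if it is nonzero and is additive over orthogonal sums; this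
   makes the splitting into minimal projections terminate, and Bessel's
   inequality makes the set of minimal projections countable.

   If [y] in [A] is self-adjoint and nonzero then b_n = ||y^(n+1)||_HS^2 is
   log-convex and submultiplicative, so b_n / r^(n+1) decreases to a limit
   >= 1, where r = lim b_(n+1) / b_n. Since ||(y^2/r)^n - (y^2/r)^m||_HS^2 is a
   second difference of this sequence, (y^2/r)^n is Cauchy in Hilbert-Schmidt
   norm; its limit is a nonzero projection Q with y^2 Q = r Q.

   Hilbert-Schmidt convergence improves to convergence in L(s',s) as soon as
   the matrices decay rapidly in each index uniformly in n, because
   i^(2q) j^(2q) <= e (i^(8q) + j^(8q)) + 1/e. The powers (y^2/r)^n and the
   partial sums E_n x, with E_n the sum of n minimal projections, satisfy this
   as E_n is a contraction commuting with x and x^*. The limit d of x - E_n x is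
   annihilated by all minimal projections, hence so is every spectral
   projection of d^* d, which is a sum of minimal ones; thus d = 0. *)

(** * Real inner product of [l2] *)

Section RealSeries.
Context {R : realType}.
Implicit Types f g : nat -> R.

Definition tsum f : R := limn (series f).

Lemma tsumD f g : cvgn (series f) -> cvgn (series g) ->
  tsum (fun j => f j + g j) = tsum f + tsum g.
Proof. exact: lim_seriesD. Qed.

Lemma tsumZ a f : cvgn (series f) -> tsum (fun j => a * f j) = a * tsum f.
Proof. exact: lim_seriesZ. Qed.

Lemma cvg_tsumD f g : cvgn (series f) -> cvgn (series g) ->
  cvgn (series (fun j => f j + g j)).
Proof. exact: is_cvg_seriesD. Qed.

Lemma cvg_series_dominated f g : (forall j, `|f j| <= g j) -> cvgn (series g) ->
  cvgn (series f).
Proof.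
move=> fg cg; apply: normed_cvg.
apply: (@series_le_cvg _ _ g) => // j; first exact: normr_ge0.
exact: le_trans (normr_ge0 _) (fg j).
Qed.

Lemma nneseries_tsum f : cvgn (series f) ->
  (\sum_(0 <= j <oo) (f j)%:E)%E = (tsum f)%:E.
Proof.
move=> cf; rewrite /tsum -EFin_lim//; congr (limn _).
by apply/funext => n; rewrite /series/= -sumEFin.
Qed.

Lemma nneseries_lty f : (forall j, 0 <= f j) ->
  (\sum_(0 <= j <oo) (f j)%:E < +oo)%E <-> cvgn (series f).
Proof.
move=> f0; split=> [h|/nneseries_tsum ->]; last exact: ltry.
by apply: nnseries_is_cvg.
Qed.

Lemma tsum_ge0 f : (forall j, 0 <= f j) -> cvgn (series f) -> 0 <= tsum f.
Proof.
move=> f0 cf; rewrite -lee_fin -nneseries_tsum//.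
by apply: nneseries_ge0 => j _ _; rewrite lee_fin.
Qed.

Lemma tsum_ge f k : (forall j, 0 <= f j) -> cvgn (series f) -> f k <= tsum f.
Proof.
move=> f0 cf; rewrite -lee_fin -nneseries_tsum//.
have := @nneseries_lim_ge R (EFin \o f) xpredT 0 k.+1.
rewrite big_nat_recr//= => h; apply: le_trans (h _); last first.
  by move=> i _; rewrite lee_fin.
by rewrite leeDr// sume_ge0// => i _; rewrite lee_fin.
Qed.

Lemma tsum_delta f k : (forall j, j != k -> f j = 0) ->
  cvgn (series f) /\ tsum f = f k.
Proof.
move=> fk; suff h : series f @ \oo --> f k by split; [apply/cvg_ex;
  exists (f k)|exact: cvg_lim].
apply: cvg_near_cst; near=> n.
rewrite /series/= (bigD1_seq k) ?iota_uniq//= ?mem_index_iota//=.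
  by rewrite big1 ?addr0// => i /fk.
by near: n; exact: nbhs_infty_gt.
Unshelve. all: by end_near. Qed.

(** Common source of the Cauchy-Schwarz inequalities for [rinner], finite sums and [hs_inner]. For
    [c > 0] evaluate at the minimiser [- b / c]; for [c = 0] a slope [b != 0] would make the affine
    function negative somewhere. *)
Lemma discriminant_le (a b c : R) : 0 <= c ->
  (forall t, 0 <= a + 2 * t * b + t ^+ 2 * c) -> b ^+ 2 <= a * c.
Proof.
move=> c0 h; have [c00|cn0] := eqVneq c 0.
  suff -> : b = 0 by rewrite expr0n c00 mulr0.
  apply/eqP; apply: contraT => bn0; have := h (- (a + 1) / (2 * b)).
  rewrite c00 mulr0 addr0 (_ : a + _ = - 1); last by field.
  by rewrite ler0N1.
have cp : 0 < c by rewrite lt_neqAle eq_sym cn0.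
have := h (- b / c); rewrite (_ : a + _ + _ = (a * c - b ^+ 2) / c); last by field.
by rewrite pmulr_lge0 ?invr_gt0// subr_ge0.
Qed.

End RealSeries.

Section InnerProduct.
Context {R : realType}.
Local Open Scope complex_scope.

Local Notation ci := (Complex 0 1 : R[i]).

(* Real part of [a * conjc b]; the real inner product suffices since operators
   are complex linear. *)
Definition re_inner (a b : R[i]) : R := 
  complex.Re a * complex.Re b + complex.Im a * complex.Im b.

Lemma normc_sqrE (a : R[i]) : ComplexField.Normc.normc a ^+ 2 = re_inner a a.
Proof. by case: a => x y; rewrite /re_inner/= sqr_sqrtr ?addr_ge0 ?sqr_ge0 -?expr2. Qed.

Lemma re_inner_ge0 a : 0 <= re_inner a a.
Proof. by rewrite -normc_sqrE sqr_ge0. Qed.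

Lemma re_inner_eq0 a : (re_inner a a == 0) = (a == 0).
Proof.
case: a => x y; rewrite eq_complex/= /re_inner/= -!expr2 paddr_eq0 ?sqr_ge0//.
by rewrite !sqrf_eq0.
Qed.

(** A crude bound read off from the squares of [a + b] and [a - b]; it suffices to dominate the
    series defining [rinner]. *)
Lemma re_inner_abs a b : `|re_inner a b| <= re_inner a a + re_inner b b.
Proof.
case: a b => a1 a2 [b1 b2]; rewrite /re_inner/= ler_norml.
have := sqr_ge0 (a1 - b1); have := sqr_ge0 (a1 + b1).
have := sqr_ge0 (a2 - b2); have := sqr_ge0 (a2 + b2).
rewrite !sqrrD !sqrrN !mulrN => *.
have := sqr_ge0 a1; have := sqr_ge0 a2; have := sqr_ge0 b1; have := sqr_ge0 b2.
rewrite -!expr2 => *; apply/andP; split; lra.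
Qed.

Lemma re_innerC a b : re_inner a b = re_inner b a.
Proof. by rewrite /re_inner ![complex.Re a * _]mulrC ![complex.Im a * _]mulrC. Qed.

Lemma re_innerDl a b c : re_inner (a + b) c = re_inner a c + re_inner b c.
Proof. by case: a b => [? ?] [? ?]; rewrite /re_inner/=; ring. Qed.

Lemma re_innerZl (t : R) a b : re_inner (t%:C * a) b = t * re_inner a b.
Proof. by case: a => [? ?]; rewrite /re_inner/=; ring. Qed.

Lemma re_inner_mul a b : re_inner (a * b) (a * b) = re_inner a a * re_inner b b.
Proof. by rewrite -!normc_sqrE ComplexField.Normc.normcM exprMn. Qed.

Lemma in_l2P (u : nat -> R[i]) :
  u \in in_l2 <-> cvgn (series (fun j => re_inner (u j) (u j))).
Proof.
rewrite inE -(nneseries_lty (fun j => re_inner_ge0 _)).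
rewrite /norm_s /weighted_norm.
rewrite (eq_eseriesr (g := fun j => (re_inner (u j) (u j))%:E)); last first.
  by move=> j _; rewrite muln0 expr0 mul1r normc_sqrE.
set S := (\sum_(_ <= _ <oo) _)%E; have : (0 <= S)%E.
  by apply: nneseries_ge0 => j _ _; rewrite lee_fin re_inner_ge0.
by case: S => [r _||//]; split => // _; exact: ltry.
Qed.

Implicit Types u v w : l2 R.

Definition rinner u v : R := tsum (fun j => re_inner (u j) (v j)).

Lemma cvg_l2 u : cvgn (series (fun j => re_inner (u j) (u j))).
Proof. exact/in_l2P/l2_valP. Qed.

Lemma cvg_rinner u v : cvgn (series (fun j => re_inner (u j) (v j))).
Proof.
apply: (@cvg_series_dominated _ _ (fun j => re_inner (u j) (u j) + re_inner (v j) (v j))).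
  by move=> j; exact: re_inner_abs.
by apply: cvg_tsumD; exact: cvg_l2.
Qed.

Lemma rinnerC u v : rinner u v = rinner v u.
Proof. by congr tsum; apply/funext => j; rewrite re_innerC. Qed.

Lemma rinnerDl u v w : rinner (u + v) w = rinner u w + rinner v w.
Proof.
rewrite /rinner -tsumD; [|exact: cvg_rinner|exact: cvg_rinner].
by congr tsum; apply/funext => j; rewrite -re_innerDl.
Qed.

Lemma rinnerZl (t : R) u v : rinner (t%:C *: u) v = t * rinner u v.
Proof.
rewrite /rinner -tsumZ; last exact: cvg_rinner.
by congr tsum; apply/funext => j; rewrite -re_innerZl.
Qed.

Lemma rinnerNl u v : rinner (- u) v = - rinner u v.
Proof. by rewrite -scaleN1r -[-1]/((-1) +i* (-0)) oppr0 rinnerZl mulN1r. Qed.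

Lemma rinnerBl u v w : rinner (u - v) w = rinner u w - rinner v w.
Proof. by rewrite rinnerDl rinnerNl. Qed.

Lemma rinnerDr u v w : rinner w (u + v) = rinner w u + rinner w v.
Proof. by rewrite rinnerC rinnerDl !(rinnerC w). Qed.

Lemma rinnerBr u v w : rinner w (u - v) = rinner w u - rinner w v.
Proof. by rewrite rinnerC rinnerBl !(rinnerC w). Qed.

Lemma rinnerZr (t : R) u v : rinner u (t%:C *: v) = t * rinner u v.
Proof. by rewrite rinnerC rinnerZl rinnerC. Qed.

Lemma rinner0l u : rinner 0 u = 0.
Proof. by rewrite -[0](subrr 0) rinnerBl subrr. Qed.

Lemma rinner_i u v : rinner (ci *: u) v = - rinner u (ci *: v).
Proof.
rewrite -mulN1r -rinnerZr; congr tsum; apply/funext => j.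
rewrite -[l2_val (ci *: u) j]/(ci * u j).
rewrite -[l2_val ((-1)%:C *: _) j]/((-1)%:C * (ci * v j)).
by case: (u j) (v j) => [a b] [c d]; rewrite /re_inner/=; ring.
Qed.

Definition n2 u := rinner u u.

Lemma n2_ge0 u : 0 <= n2 u.
Proof. by apply: tsum_ge0 => [j|]; [exact: re_inner_ge0|exact: cvg_l2]. Qed.

Lemma n2_coord u j : re_inner (u j) (u j) <= n2 u.
Proof. by apply: (@tsum_ge _ (fun j => re_inner (u j) (u j))) => [?|];
  [exact: re_inner_ge0|exact: cvg_l2]. Qed.

Lemma n2_eq0 u : n2 u = 0 -> u = 0.
Proof.
move=> u0; apply/val_inj/funext => j; apply/eqP; rewrite -re_inner_eq0 eq_le re_inner_ge0.
by rewrite andbT -u0 n2_coord.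
Qed.

Lemma rinner_CS u v : rinner u v ^+ 2 <= n2 u * n2 v.
Proof.
apply: discriminant_le; first exact: n2_ge0.
move=> t; have := n2_ge0 (u + t%:C *: v).
rewrite /n2 rinnerDl !rinnerDr !rinnerZl !rinnerZr (rinnerC v u).
by congr (_ <= _); ring.
Qed.

Lemma n2B u v : n2 (u - v) = n2 u - 2 * rinner u v + n2 v.
Proof. by rewrite /n2 rinnerBl !rinnerBr (rinnerC v u); ring. Qed.

Lemma n2_0 : n2 0 = 0.
Proof. exact: rinner0l. Qed.

Lemma n2Z (a : R[i]) u : n2 (a *: u) = re_inner a a * n2 u.
Proof.
rewrite /n2 /rinner -tsumZ; last exact: cvg_l2.
by congr tsum; apply/funext => j; rewrite -re_inner_mul.
Qed.

Lemma n2_D_le u v : n2 (u + v) <= 2 * (n2 u + n2 v).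
Proof.
have := n2_ge0 (u - v); rewrite n2B /n2 rinnerDl !rinnerDr (rinnerC v u); lra.
Qed.

Definition basis_fun (j i : nat) : R[i] := (i == j)%:R.

Lemma in_s_basis j : basis_fun j \in @in_s R.
Proof.
apply/asboolP => q; rewrite /norm_s /weighted_norm nneseries_tsum ?ltry//.
by have [] := @tsum_delta R (fun i => i.+1%:R ^+ (2 * q) *
   ComplexField.Normc.normc (basis_fun j i) ^+ 2) j _ => // i ij;
   rewrite /basis_fun (negbTE ij) normc_sqrE /re_inner/= !mul0r addr0 mulr0.
Qed.

Definition s_basis j : s R := S (in_s_basis j).
Definition l2_basis j : l2 R := s_to_l2 (s_basis j).

(** Pairing with complex multiples of a basis vector makes the real inner product see both parts of
    a coordinate. *)
Lemma rinner_basis u (a : R[i]) j : rinner u (a *: l2_basis j) = re_inner (u j) a.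
Proof.
have [|_ e] := @tsum_delta R (fun i => re_inner (u i) ((a *: l2_basis j) i)) j.
  move=> i ij; rewrite -[l2_val (a *: l2_basis j) i]/(a * basis_fun j i) /basis_fun
    (negbTE ij) mulr0.
  by rewrite /re_inner/= !mulr0 addr0.
rewrite [LHS]e; rewrite -[l2_val (a *: l2_basis j) j]/(a * basis_fun j j) /basis_fun eqxx.
by rewrite mulr1.
Qed.

End InnerProduct.

(** * Operators on [l2] *)

Section Adjoints.
Context {R : realType}.
Local Open Scope complex_scope.
Local Notation ci := (Complex 0 1 : R[i]).
Implicit Types u v w : l2 R.

Lemma cvg_complex (f g : nat -> R) (a b : R) : f @ \oo --> a -> g @ \oo --> b ->
  (fun n => f n +i* g n : R[i]^o) @ \oo --> (a +i* b : R[i]^o).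
Proof.
move=> fa gb; apply/cvgrPdist_lt => -[e e'].
(* The radius is a complex number; positivity forces its imaginary part to vanish. *)
rewrite ltcE/= => /andP[/eqP -> e0].
have e20 : 0 < e / 2 by rewrite divr_gt0.
move/cvgrPdist_lt : fa => /(_ _ e20) fa; move/cvgrPdist_lt : gb => /(_ _ e20) gb.
near=> n.
have h1 : `|a - f n| < e / 2 by near: n.
have h2 : `|b - g n| < e / 2 by near: n.
rewrite -[_ - _]/((a - f n) +i* (b - g n)) normc_def ltcE/= eqxx/=.
apply: (@le_lt_trans _ _ (`|a - f n| + `|b - g n|)); last by lra.
rewrite -[leRHS]ger0_norm ?addr_ge0// -sqrtr_sqr ler_sqrt ?sqr_ge0// [leRHS]sqrrD.
by rewrite !real_normK ?num_real// lerD2r lerDl mulrn_wge0// mulr_ge0.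
Unshelve. all: by end_near. Qed.

(** Since [Im (a * conjc b) = Re (a * conjc (i * b))], the imaginary part is the real inner product
    with [i v]. *)
Lemma l2_innerE u v : l2_inner u v = rinner u v +i* rinner u (ci *: v).
Proof.
rewrite /l2_inner; apply: (@cvg_lim R[i]^o); first exact: norm_hausdorff.
rewrite (_ : series _ = fun n => series (fun j => re_inner (u j) (v j)) n +i*
    series (fun j => re_inner (u j) ((ci *: v) j)) n).
  by apply: cvg_complex; exact: cvg_rinner.
apply/funext; elim=> [|n IH]; first by rewrite /series/= !big_geq.
rewrite /series/= !big_nat_recr//= -[X in X + _ = _]/(series _ n) IH.
rewrite -[(_ *: _) n]/(ci * v n) /series/= /re_inner.
by case: (u n) (v n) => [a b] [c d] /=; apply/eqP; rewrite eq_complex/=; apply/andP;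
  split; apply/eqP; ring.
Qed.

(** The real identity applied to [i v] yields the imaginary part, because [g] commutes with
    multiplication by [i]. *)
Lemma l2_adjointP (f g : l2 R -> l2 R) : (forall u, g (ci *: u) = ci *: g u) ->
  l2_adjoint f g <-> forall u v, rinner (f u) v = rinner u (g v).
Proof.
move=> gi; split=> h u v; first by have := h u v; rewrite !l2_innerE => -[].
by rewrite !l2_innerE !h gi.
Qed.

End Adjoints.

Section Operators.
Context {R : realType}.
Local Open Scope complex_scope.
Local Notation ci := (Complex 0 1 : R[i]).
Implicit Types (x y z : smooth_op R) (u v w : l2 R).

Notation L := l2_restr.
Notation "x ** y" := (smooth_op_comp x y) (at level 40, left associativity).

Lemma op_linear x : linear x.
Proof. by have /asboolP[] := smooth_opP x. Qed.

Lemma op_continuous x : continuous x.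
Proof. by have /asboolP[] := smooth_opP x. Qed.

Lemma opD x a b : x (a + b) = x a + x b.
Proof. by have := op_linear x 1 a b; rewrite !scale1r. Qed.

Lemma op0 x : x 0 = 0.
Proof. by apply: (@addrI _ (x 0)); rewrite -opD !addr0. Qed.

Lemma opZ x c a : x (c *: a) = c *: x a.
Proof. by have := op_linear x c a 0; rewrite op0 !addr0. Qed.

Lemma l2_restr_linear x : linear (L x).
Proof.
move=> a u v; apply: val_inj.
rewrite /l2_restr/=.
rewrite (_ : l2_to_sdual _ = a *: l2_to_sdual u + l2_to_sdual v); last exact: val_inj.
by rewrite op_linear.
Qed.

Lemma L_addr x u v : L x (u + v) = L x u + L x v.
Proof. by have := l2_restr_linear x 1 u v; rewrite !scale1r. Qed.

Lemma L_zeror x : L x 0 = 0.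
Proof. by apply: (@addrI _ (L x 0)); rewrite -L_addr !addr0. Qed.

Lemma L_scaler x a u : L x (a *: u) = a *: L x u.
Proof. by have := l2_restr_linear x a u 0; rewrite L_zeror !addr0. Qed.

Lemma L_oppr x u : L x (- u) = - L x u.
Proof. by rewrite -scaleN1r L_scaler scaleN1r. Qed.

Lemma L_subr x u v : L x (u - v) = L x u - L x v.
Proof. by rewrite L_addr L_oppr. Qed.

Lemma L_add x y u : L (x + y) u = L x u + L y u.
Proof. exact: val_inj. Qed.

Lemma L_scale a x u : L (a *: x) u = a *: L x u.
Proof. exact: val_inj. Qed.

Lemma L_zero u : L 0 u = 0.
Proof. exact: val_inj. Qed.

Lemma L_opp x u : L (- x) u = - L x u.
Proof. exact: val_inj. Qed.

Lemma L_sub x y u : L (x - y) u = L x u - L y u.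
Proof. by rewrite L_add L_opp. Qed.

Lemma L_comp x y u : L (x ** y) u = L x (L y u).
Proof. exact: val_inj. Qed.

Lemma L_sum (I : Type) (r : seq I) (P : pred I) (F : I -> smooth_op R) u :
  L (\sum_(i <- r | P i) F i) u = \sum_(i <- r | P i) L (F i) u.
Proof.
by elim/big_ind2: _ => [|x a y b <- <-|//]; [exact: L_zero|exact: L_add].
Qed.

Lemma L_continuous x : continuous (L x).
Proof.
move=> u; apply: continuous_comp; last apply: continuous_comp.
- move: u; apply/continuousP => U oU.
  suff : norm_open (fun (_ : nat) (x : l2 R) => norm_s 0 x) (l2_to_sdual @^-1` U) by [].
  have {}oU : sdual_open U by [].
  move=> z /= /oU[V [_ V2] h]; have [d [d0 hd]] := V2 0%N.
  exists 0%N, d; split=> // v /(_ 0%N isT) vd.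
  rewrite (_ : l2_to_sdual _ = l2_to_sdual z + l2_to_sdual v); last exact: val_inj.
  by apply: h; apply: hd; rewrite norm_sdual0.
- exact: op_continuous.
- move: (x _); apply/continuousP => U oU.
  suff : norm_open (fun q (x : s R) => norm_s q x) (s_to_l2 @^-1` U) by [].
  have {}oU : norm_open (fun (_ : nat) (x : l2 R) => norm_s 0 x) U by [].
  move=> z /= /oU[n [d [d0 hd]]]; exists 0%N, d; split=> // v /(_ 0%N isT) vd.
  rewrite (_ : s_to_l2 _ = s_to_l2 z + s_to_l2 v); last exact: val_inj.
  by apply: hd => k _.
Qed.

Definition adjoint x y := forall u v, rinner (L x u) v = rinner u (L y v).
Definition herm x := adjoint x x.

Lemma adjointP x y : l2_adjoint (L x) (L y) <-> adjoint x y.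
Proof. by apply: l2_adjointP => u; rewrite L_scaler. Qed.

Lemma l2_projectionP x :
  l2_projection (L x) <-> herm x /\ forall u, L x (L x u) = L x u.
Proof.
split=> [[_ _ h1 /adjointP h2]|[h1 h2]].
  by split=> // u; rewrite -[in RHS]h1.
split; [exact: l2_restr_linear|exact: L_continuous| |exact/adjointP].
by apply/funext => u; exact: h2.
Qed.

Lemma adjointC x y : adjoint x y -> adjoint y x.
Proof. by move=> h u v; rewrite rinnerC -h rinnerC. Qed.

Lemma adjointD x y x' y' : adjoint x x' -> adjoint y y' -> adjoint (x + y) (x' + y').
Proof. by move=> h h' u v; rewrite !L_add rinnerDl rinnerDr h h'. Qed.

Lemma adjoint_scale (t : R) x x' : adjoint x x' -> adjoint (t%:C *: x) (t%:C *: x').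
Proof. by move=> h u v; rewrite !L_scale rinnerZl rinnerZr h. Qed.

Lemma adjointN x x' : adjoint x x' -> adjoint (- x) (- x').
Proof. by move=> h u v; rewrite !L_opp rinnerNl h rinnerC -rinnerNl rinnerC. Qed.

Lemma adjointB x y x' y' : adjoint x x' -> adjoint y y' -> adjoint (x - y) (x' - y').
Proof. by move=> h h'; apply: adjointD => //; exact: adjointN. Qed.

Lemma adjointM x y x' y' : adjoint x x' -> adjoint y y' -> adjoint (x ** y) (y' ** x').
Proof. by move=> h h' u v; rewrite !L_comp h h'. Qed.

Lemma adjoint_i x x' : adjoint x x' -> adjoint (ci *: x) (- ci *: x').
Proof.
by move=> h u v; rewrite !L_scale rinner_i h scaleNr rinnerC -rinnerNl rinnerC L_scaler.
Qed.

(** The matrix of [y] is the conjugate transpose of that of [x]; testing with 1 and [i] recovers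
    both parts of an entry. Column estimates for [y] thereby become row estimates for [x]. *)
Lemma adjoint_entry x y i j : adjoint x y ->
  re_inner (L x (l2_basis j) i) (L x (l2_basis j) i) = re_inner (L y (l2_basis i) j) (L
    y (l2_basis i) j).
Proof.
move=> h; have h2 c : re_inner (L x (l2_basis j) i) c = re_inner (c * L y (l2_basis i)
  j) 1.
  by rewrite -rinner_basis h L_scaler rinnerC -[X in rinner _ X]scale1r rinner_basis.
rewrite h2; set a := L x _ _; set b := L y _ _.
have := h2 1; have := h2 ci; rewrite -/a -/b; case: a b => [a1 a2] [b1 b2].
rewrite /re_inner/= !mulr1 !mulr0 !mul0r !mul1r !addr0 !sub0r !add0r => -> ->.
by ring.
Qed.

End Operators.

(** * Bounds and completeness in [L(s',s)] *)

Section PartialSumBounds.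
Context {R : realType}.
Local Open Scope complex_scope.
Implicit Types (w : nat -> R) (x y : nat -> R[i]).

(* The bound [\sum_i w_i |x_i|^2 <= C], stated through partial sums to stay
   within finite real sums. *)
Definition sqle w x (C : R) : Prop :=
  forall n, \sum_(i < n) w i * re_inner (x i) (x i) <= C.

Lemma sqle_ge0 w x C : sqle w x C -> 0 <= C.
Proof. by move=> /(_ 0%N); rewrite big_ord0. Qed.

Lemma sqle_le w x C D : C <= D -> sqle w x C -> sqle w x D.
Proof. by move=> CD h n; exact: le_trans CD. Qed.

Lemma sqle_weight w1 w2 x C : (forall j, w1 j <= w2 j) -> sqle w2 x C ->
  sqle w1 x C.
Proof.
move=> w12 h n; apply: le_trans (h n); apply: ler_sum => i _.
by rewrite ler_wpM2r// re_inner_ge0.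
Qed.

Lemma sqle_eq w x C : (forall e, 0 < e -> sqle w x (C + e)) -> sqle w x C.
Proof. by move=> h n; apply/ler_addgt0Pr => e /h. Qed.

Section Weight.
Variable w : nat -> R.
Hypothesis w0 : forall j, 0 <= w j.

Lemma sqle_seriesP x C : sqle w x C <->
  cvgn (series (fun j => w j * re_inner (x j) (x j))) /\
  tsum (fun j => w j * re_inner (x j) (x j)) <= C.
Proof.
set g := fun j => _; have g0 j : 0 <= g j by rewrite mulr_ge0// re_inner_ge0.
have nd : nondecreasing_seq (series g) by apply: nondecreasing_series.
split=> [h|[cg gC] n].
  have b n : series g n <= C by rewrite /series/= big_mkord.
  have cg : cvgn (series g).
    by apply: nondecreasing_is_cvgn => //; exists C => _ [n _ <-].
  by split=> //; apply: limr_le => //; near=> n.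
apply: le_trans gC; have := nondecreasing_cvgn_le nd cg n.
by rewrite /series/= big_mkord.
Unshelve. all: by end_near. Qed.

Lemma weighted_norm_sqle x (e : R) : 0 <= e ->
  (weighted_norm w x <= e%:E)%E <-> sqle w x (e ^+ 2).
Proof.
move=> e0; rewrite -[in X in X <-> _](ger0_norm e0).
have -> : `|e|%:E = sqrte ((e ^+ 2)%:E) by rewrite /= sqrtr_sqr.
rewrite /weighted_norm lee_sqrt ?lee_fin ?sqr_ge0//.
under eq_eseriesr do rewrite normc_sqrE.
have g0 j : 0 <= w j * re_inner (x j) (x j) by rewrite mulr_ge0// re_inner_ge0.
split=> [h|/sqle_seriesP[cg gC]]; last by rewrite nneseries_tsum.
have cg : cvgn (series (fun j => w j * re_inner (x j) (x j))).
  by apply/nneseries_lty => //; exact: le_lt_trans h (ltry _).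
by apply/sqle_seriesP; split=> //; rewrite -lee_fin -nneseries_tsum.
Qed.

Lemma weighted_norm_lt_sqle x (e : R) : 0 < e -> (weighted_norm w x < e%:E)%E ->
  sqle w x (e ^+ 2).
Proof. by move=> e0 /ltW /weighted_norm_sqle; apply; exact: ltW. Qed.

Lemma sqle_weighted_norm_lt x C (e : R) : 0 < e -> C < e ^+ 2 -> sqle w x C ->
  (weighted_norm w x < e%:E)%E.
Proof.
move=> e0 Ce h; have C0 := sqle_ge0 h.
apply: (@le_lt_trans _ _ (Num.sqrt C)%:E).
  by apply/weighted_norm_sqle; rewrite ?sqrtr_ge0// sqr_sqrtr.
by rewrite lte_fin -(ger0_norm (ltW e0)) -sqrtr_sqr ltr_sqrt// exprn_gt0.
Qed.

Lemma weighted_norm_fin_sqle x : (weighted_norm w x < +oo)%E <->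
  exists C, sqle w x C.
Proof.
split=> [/weighted_norm_finP[e e0 h]|[C h]].
  by exists (e ^+ 2); exact: weighted_norm_lt_sqle.
have C0 := sqle_ge0 h; apply/weighted_norm_finP; exists (C + 1).
  by rewrite ltr_wpDl.
by apply: sqle_weighted_norm_lt h; [rewrite ltr_wpDl|rewrite sqrrD; nra].
Qed.

Lemma sqleZ x C a : sqle w x C -> sqle w (a *: x) (re_inner a a * C).
Proof.
move=> h n; rewrite (eq_bigr (fun i : 'I_n => re_inner a a * (w i * re_inner (x i) (x
  i)))).
  by rewrite -mulr_sumr; apply: ler_wpM2l; [exact: re_inner_ge0|exact: h].
by move=> i _; rewrite -[(a *: x) i]/(a * x i) re_inner_mul mulrCA.
Qed.

Lemma sqle_unscale x C (t : R) : 0 < t -> sqle w (t%:C *: x) C ->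
  sqle w x (C / t ^+ 2).
Proof.
move=> t0 /(sqleZ t^-1%:C); rewrite scalerA.
rewrite (_ : t^-1%:C * t%:C = 1) ?scale1r.
  by apply: sqle_le; rewrite mulrC /re_inner/= mulr0 addr0 -expr2 exprVn.
by rewrite -rmorphM mulVf ?gt_eqF.
Qed.

(** With [v], [s] the moduli of [c], [d], the triangle inequality leaves [(p v + q s)^2], and [p v^2
    + q s^2 - (p v + q s)^2 = (1 - p - q) (p v^2 + q s^2) + p q (v - s)^2]. *)
Lemma re_inner_convex (a b c d : R[i]) :
  let p := ComplexField.Normc.normc a in let q := ComplexField.Normc.normc b in
  p + q <= 1 -> re_inner (a * c + b * d) (a * c + b * d) <= p * re_inner c c + q *
    re_inner d d.
Proof.
move=> p q pq; rewrite -!normc_sqrE.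
have := le_normcD (a * c) (b * d); rewrite !ComplexField.Normc.normcM -/p -/q.
have : 0 <= p by case: (a) @p {pq} => ? ? /=; exact: sqrtr_ge0.
have : 0 <= q by case: (b) @q {pq} => ? ? /=; exact: sqrtr_ge0.
have : 0 <= ComplexField.Normc.normc (a * c + b * d).
  by case: (a * c + b * d) => ? ?; exact: sqrtr_ge0.
move: (ComplexField.Normc.normc _) (ComplexField.Normc.normc _)
  (ComplexField.Normc.normc _) => s v u u0 q0 p0 h.
apply: (@le_trans _ _ ((p * v + q * s) ^+ 2)).
  by rewrite ler_sqr ?nnegrE// (le_trans u0 h).
have := mulr_ge0 (mulr_ge0 p0 q0) (sqr_ge0 (v - s)).
have : 0 <= (1 - (p + q)) * (p * v ^+ 2 + q * s ^+ 2).
  by rewrite mulr_ge0 ?subr_ge0// addr_ge0// mulr_ge0// sqr_ge0.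
nra.
Qed.

(** Absolute convexity of the sublevel sets, the property demanded of neighbourhoods of 0 in the
    inductive limit. *)
Lemma sqle_convex x y C a b : `|a| + `|b| <= 1 -> sqle w x C -> sqle w y C ->
  sqle w (a *: x + b *: y) C.
Proof.
rewrite !normc_def -rmorphD lecR => ab hx hy n.
pose p := ComplexField.Normc.normc a; pose q := ComplexField.Normc.normc b.
have pq : p + q <= 1 by move: ab; rewrite /p /q; case: (a) => ? ?; case: (b).
have p0 : 0 <= p by rewrite /p; case: (a) => ? ?; exact: sqrtr_ge0.
have q0 : 0 <= q by rewrite /q; case: (b) => ? ?; exact: sqrtr_ge0.
apply: (@le_trans _ _ (p * (\sum_(i < n) w i * re_inner (x i) (x i)) +
    q * (\sum_(i < n) w i * re_inner (y i) (y i)))).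
  rewrite !mulr_sumr -big_split/=; apply: ler_sum => i _.
  rewrite -[(a *: x + b *: y) i]/(a * x i + b * y i) [X in _ <= X + _]mulrCA.
  by rewrite [X in _ <= _ + X]mulrCA -mulrDr ler_wpM2l// re_inner_convex.
have C0 := sqle_ge0 hx.
have := ler_wpM2l p0 (hx n); have := ler_wpM2l q0 (hy n); nra.
Qed.

(** Rests on [d^-1 (d p - q)^2 >= 0] for the real and the imaginary parts separately. A small [d]
    keeps the first constant close to 1. *)
Lemma re_inner_Young (a b : R[i]) (d : R) : 0 < d ->
  re_inner (a + b) (a + b) <= (1 + d) * re_inner a a + (1 + d^-1) * re_inner b b.
Proof.
move=> d0; case: a b => [a1 a2] [b1 b2]; rewrite /re_inner/= -!expr2.
have h (p q : R) : (p + q) ^+ 2 <= (1 + d) * p ^+ 2 + (1 + d^-1) * q ^+ 2.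
  have : 0 <= d^-1 * (d * p - q) ^+ 2 by rewrite mulr_ge0 ?sqr_ge0// invr_ge0 ltW.
  have -> : d^-1 * (d * p - q) ^+ 2 = d * p ^+ 2 - 2 * p * q + d^-1 * q ^+ 2.
    by field; rewrite gt_eqF.
  rewrite sqrrD; lra.
by have := h a1 b1; have := h a2 b2; lra.
Qed.

Lemma sqle_Young x y C D (d : R) : 0 < d -> sqle w x C -> sqle w y D ->
  sqle w (x + y) ((1 + d) * C + (1 + d^-1) * D).
Proof.
move=> d0 hx hy n.
apply: (@le_trans _ _ ((1 + d) * (\sum_(i < n) w i * re_inner (x i) (x i)) +
    (1 + d^-1) * (\sum_(i < n) w i * re_inner (y i) (y i)))).
  rewrite !mulr_sumr -big_split/=; apply: ler_sum => i _.
  rewrite -[(x + y) i]/(x i + y i) [X in _ <= X + _]mulrCA.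
  by rewrite [X in _ <= _ + X]mulrCA -mulrDr ler_wpM2l// re_inner_Young.
by rewrite lerD// ler_wpM2l// ltW// addr_gt0// invr_gt0.
Qed.

Lemma sqleD x y C D : sqle w x C -> sqle w y D -> sqle w (x + y) (2 * (C + D)).
Proof.
move=> hx hy; have := sqle_Young ltr01 hx hy; apply: sqle_le; rewrite invr1; lra.
Qed.

End Weight.
End PartialSumBounds.

(** * Continuity of operators in terms of weighted norm bounds *)

Section OperatorBounds.
Context {R : realType}.
Local Open Scope complex_scope.

Definition s_weight q (j : nat) : R := j.+1%:R ^+ (2 * q).
Definition dual_weight q (j : nat) : R := j.+1%:R ^- (2 * q).

Lemma s_weight_ge0 q j : 0 <= s_weight q j. Proof. exact: weight_s_ge0. Qed.
Lemma dual_weight_ge0 q j : 0 <= dual_weight q j. Proof. exact: weight_sdual_ge0. Qed.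
Lemma s_weight_gt0 q j : 0 < s_weight q j. Proof. by rewrite exprn_gt0. Qed.

Lemma le_s_weight q r j : (q <= r)%N -> s_weight q j <= s_weight r j.
Proof. by move=> qr; rewrite ler_weXn2l ?leq_mul2l// ler1n. Qed.

Lemma le_dual_weight q r j : (q <= r)%N -> dual_weight r j <= dual_weight q j.
Proof. by move=> qr; rewrite lef_pV2 ?posrE ?s_weight_gt0// le_s_weight. Qed.

Lemma in_sE (y : nat -> R[i]) :
  (y \in in_s) <-> (forall q, exists C, sqle (s_weight q) y C).
Proof.
split=> [/asboolP h q|h]; first exact/(weighted_norm_fin_sqle (s_weight_ge0 q))/h.
by apply/asboolP => q; exact/(weighted_norm_fin_sqle (s_weight_ge0 q))/h.
Qed.

Lemma sdual_sqle (xi : sdual R) : exists q C, sqle (dual_weight q) xi C.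
Proof.
have /asboolP[q h] := sdual_valP xi; exists q.
exact/(weighted_norm_fin_sqle (dual_weight_ge0 q))/h.
Qed.

Implicit Types (f g : sdual R -> s R) (x y : smooth_op R).

(* [||f||_q^2 <= C], without supremum in the extended reals. *)
Definition op_bound q f (C : R) : Prop :=
  forall (xi : sdual R) C', sqle (dual_weight q) xi C' -> sqle (s_weight q) (f xi) (C *
    C').

Lemma op_bound_le q f C D : C <= D -> op_bound q f C -> op_bound q f D.
Proof.
by move=> CD h xi C' hxi; apply: sqle_le (h _ _ hxi); rewrite ler_wpM2r// (sqle_ge0 hxi).
Qed.

Lemma op_bound_scale q f K : (forall c a, f (c *: a) = c *: f a) ->
  (forall xi : sdual R, sqle (dual_weight q) xi 1 -> sqle (s_weight q) (f xi) K) ->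
    op_bound q f K.
Proof.
move=> fZ h xi C hxi; have C0 := sqle_ge0 hxi.
have K0 : 0 <= K.
  have h0 : sqle (dual_weight q) (0 : sdual R) 1.
    move=> n; rewrite big1// => i _; rewrite /re_inner/=.
    by rewrite !mulr0 addr0 mulr0.
  exact: sqle_ge0 (h _ h0).
(* Normalising by some [t > C] avoids dividing by zero when [C = 0]; afterwards [t] is moved down to
   [C]. *)
have H t : C < t -> sqle (s_weight q) (f xi) (t * K).
  move=> Ct; have t0 : 0 < t by exact: le_lt_trans Ct.
  have s0 : 0 < (Num.sqrt t)^-1 by rewrite invr_gt0 sqrtr_gt0.
  have e : (Num.sqrt t)^-1 ^+ 2 = t^-1 by rewrite exprVn sqr_sqrtr// ltW.
  have /h : sqle (dual_weight q) ((Num.sqrt t)^-1%:C *: xi) 1.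
    have := sqleZ ((Num.sqrt t)^-1%:C) hxi; apply: sqle_le.
    by rewrite /re_inner/= mulr0 addr0 -expr2 e mulrC ler_pdivrMr// mul1r ltW.
  rewrite fZ => /(sqle_unscale s0); rewrite e invrK mulrC.
  exact.
apply: sqle_eq => e e0; have /H : C < C + e / (K + 1).
  by rewrite ltrDl divr_gt0// ltr_wpDl.
apply: sqle_le; rewrite mulrDl mulrC lerD2l -mulrA ler_piMr ?ltW//.
by rewrite mulrC ltr_pdivrMr ?ltr_wpDl// mul1r ltrDl.
Qed.

Lemma op_norm_lt_bound q x e : 0 < e -> (op_norm q x < e%:E)%E -> op_bound q x (e ^+ 2).
Proof.
move=> e0 xe; apply: op_bound_scale; first exact: opZ.
move=> xi hxi; apply: (weighted_norm_lt_sqle (s_weight_ge0 q)) => //.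
apply: le_lt_trans xe; apply: ereal_sup_ubound; exists xi => //=.
by apply/(weighted_norm_sqle (dual_weight_ge0 q)) => //; rewrite expr1n.
Qed.

Lemma op_bound_norm_lt q x C e : 0 < e -> C < e ^+ 2 -> 0 <= C -> op_bound q x C ->
  (op_norm q x < e%:E)%E.
Proof.
move=> e0 Ce C0 h; apply: (@le_lt_trans _ _ (Num.sqrt C)%:E).
  apply: ge_ereal_sup => _ [xi /= hxi <-].
  apply/(weighted_norm_sqle (s_weight_ge0 q)); first exact: sqrtr_ge0.
  rewrite sqr_sqrtr// -[C]mulr1; apply: h; rewrite -(expr1n _ 2).
  exact/(weighted_norm_sqle (dual_weight_ge0 q)).
by rewrite lte_fin -(ger0_norm (ltW e0)) -sqrtr_sqr ltr_sqrt// exprn_gt0.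
Qed.

(** Continuity gives a neighbourhood of 0 mapped into the unit ball of the [q]-th norm; in the
    [q]-th dual space it contains a ball of radius [d], and homogeneity does the rest. Half the
    radius leaves room for the strict inequality. *)
Lemma op_bound_exists q x : exists2 C, 0 <= C & op_bound q x C.
Proof.
have /asboolP[lx cx] := smooth_opP x.
have [V [_ /(_ q)[d [d0 hd]]] hV] := (linear_continuousP lx).1 cx q 1 ltr01.
have d20 : 0 < d / 2 by rewrite divr_gt0.
exists (((d / 2) ^+ 2)^-1); first by rewrite invr_ge0 sqr_ge0.
apply: op_bound_scale; first exact: opZ.
move=> xi hxi; rewrite -[_^-1]mul1r; apply: sqle_unscale => //.
rewrite -[_ *: _]/(s_val ((d / 2)%:C *: x xi)) -opZ -[X in sqle _ _ X](expr1n R 2).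
apply: (weighted_norm_lt_sqle (s_weight_ge0 q)) => //; apply: hV => //; apply: hd.
rewrite -[sdual_val (_ *: _)]/((d / 2)%:C *: sdual_val xi).
apply: (sqle_weighted_norm_lt (dual_weight_ge0 q) d0 _ (sqleZ ((d / 2)%:C) hxi)).
by rewrite /re_inner/= mulr0 addr0; nra.
Qed.

Lemma op_boundD q f g C D : op_bound q f C -> op_bound q g D ->
  op_bound q (fun xi => f xi + g xi) (2 * (C + D)).
Proof.
move=> hf hg xi C' h; have := sqleD (s_weight_ge0 q) (hf _ _ h) (hg _ _ h).
by apply: sqle_le; rewrite -mulrDl mulrA.
Qed.

(** Preimages of balls are absolutely convex. They meet the [q]-th dual space in a neighbourhood of
    0 by the bound at index [maxn n q], whose dual norm is below the [q]-th and whose norm on [s] is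
    above the [n]-th. *)
Lemma smooth_op_of_bound f : linear f -> (forall q, exists2 C, 0 <= C & op_bound q f C) ->
  f \in is_smooth_op.
Proof.
move=> lf hb; apply/asboolP; split=> //; apply/(linear_continuousP lf) => n e e0.
have fD a b : f (a + b) = f a + f b by have := lf 1 a b; rewrite !scale1r.
have f0 : f 0 = 0 by apply: (@addrI _ (f 0)); rewrite -fD !addr0.
have fZ c a : f (c *: a) = c *: f a by have := lf c a 0; rewrite f0 !addr0.
pose e2 := e / 2; have e20 : 0 < e2 by rewrite divr_gt0.
exists [set v | sqle (s_weight n) (f v) (e2 ^+ 2)].
  split=> [a b u v ab /= hu hv|q].
    by rewrite fD !fZ; exact: (sqle_convex (s_weight_ge0 n)).
  have [C C0 hC] := hb (maxn n q).
  exists (e2 / (C + 1)); split=> [|v hv]; first by rewrite divr_gt0// ltr_wpDl.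
  have C1 : 0 < C + 1 by rewrite ltr_wpDl.
  have h1 : sqle (dual_weight (maxn n q)) v ((e2 / (C + 1)) ^+ 2).
    apply: sqle_weight; first by move=> j; apply: le_dual_weight; exact: leq_maxr.
    by apply: (weighted_norm_lt_sqle (dual_weight_ge0 q)) => //; rewrite divr_gt0.
  have := hC _ _ h1; move/(sqle_weight (fun j => le_s_weight j (leq_maxl n q))).
  apply: sqle_le; rewrite expr_div_n mulrCA ler_piMr ?sqr_ge0//.
  by rewrite ler_pdivrMr ?exprn_gt0// mul1r sqrrD; nra.
move=> v /= hv k kn; apply: (sqle_weighted_norm_lt (s_weight_ge0 k) e0 _
  (sqle_weight (fun j => le_s_weight j kn) hv)).
by rewrite /e2; nra.
Qed.

End OperatorBounds.

(** * Operator bounds from matrix entries *)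

Section HilbertSchmidtBound.
Context {R : realType}.
Local Open Scope complex_scope.
Notation L := l2_restr.
Implicit Types (x y : smooth_op R) (xi : sdual R).

Definition trunc N xi : sdual R := \sum_(j < N) xi j *: s_to_sdual (s_basis j).

Lemma truncS N xi : trunc N.+1 xi = trunc N xi + xi N *: s_to_sdual (s_basis N).
Proof. by rewrite /trunc big_ord_recr. Qed.

Lemma trunc0 xi : trunc 0 xi = 0.
Proof. exact: big_ord0. Qed.

Lemma truncE N xi i : trunc N xi i = if (i < N)%N then xi i else 0.
Proof.
elim: N => [|N IH]; first by rewrite trunc0.
rewrite truncS -[LHS]/(trunc N xi i + xi N * basis_fun N i) IH /basis_fun.
rewrite ltnS; case: ltngtP => [iN|iN|->]; rewrite ?mulr0 ?addr0 ?mulr1 ?add0r//.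
Qed.

Lemma op_trunc x N xi i :
  x (trunc N xi) i = \sum_(j < N) xi j * L x (l2_basis j) i.
Proof.
elim: N => [|N IH]; first by rewrite trunc0 big_ord0 op0.
by rewrite truncS opD opZ big_ord_recr/= -IH.
Qed.

Lemma trunc_tail (w : nat -> R) xi C e : (forall j, 0 <= w j) ->
  sqle w xi C -> 0 < e -> exists N, sqle w (xi - trunc N xi) e.
Proof.
move=> w0 /(sqle_seriesP w0)[cg _] e0.
set g := (X in series X) in cg.
have g0 j : 0 <= g j by rewrite mulr_ge0// re_inner_ge0.
have nd : nondecreasing_seq (series g) by apply: nondecreasing_series.
move/cvgrPdist_lt : (cg) => /(_ _ e0)[N _ /(_ N (leqnn N))] hN.
exists N => M.
have sub i : (sdual_val (xi - trunc N xi)) i = if (i < N)%N then 0 else xi i.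
  rewrite -[LHS]/(xi i - trunc N xi i) truncE; case: ifP => _; first exact: subrr.
  exact: subr0.
have h : series g M <= limn (series g) by exact: nondecreasing_cvgn_le.
have z : re_inner 0 0 = 0 :> R by rewrite /re_inner/= mulr0 addr0.
have [MN|NM] := leqP M N.
  rewrite big1 ?ltW// => i _; rewrite sub (leq_trans (ltn_ord i) MN).
  by rewrite z mulr0.
apply: le_trans _ (ltW hN); apply: le_trans _ (ler_norm _).
apply: (@le_trans _ _ (series g M - series g N)); last by rewrite lerD2r.
rewrite [leRHS](sub_series_geq _ (ltnW NM)).
pose F i := w i * re_inner ((xi - trunc N xi : sdual R) i) ((xi - trunc N xi : sdual R)
  i).
have FE i : F i = if (i < N)%N then 0 else g i.
  by rewrite /F sub; case: ifP => _ //; rewrite z mulr0.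
rewrite -(big_mkord xpredT F); move: F FE => {}F FE.
rewrite (big_cat_nat (n := N) (leq0n N) (ltnW NM))/= big_nat_cond big1 ?add0r.
  rewrite le_eqVlt; apply/orP; left; apply/eqP; apply: eq_big_nat => i /andP[Ni _].
  by rewrite FE ltnNge Ni.
by move=> i /andP[/andP[_ iN] _]; rewrite FE iN.
Qed.

Lemma sum_CS n (p q : 'I_n -> R) :
  (\sum_i p i * q i) ^+ 2 <= (\sum_i p i ^+ 2) * (\sum_i q i ^+ 2).
Proof.
apply: discriminant_le => [|t]; first by apply: sumr_ge0 => i _; exact: sqr_ge0.
rewrite (_ : _ + _ = \sum_i (p i + t * q i) ^+ 2).
  by apply: sumr_ge0 => i _; exact: sqr_ge0.
rewrite !mulr_sumr -!big_split/=; apply: eq_bigr => i _; ring.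
Qed.

Lemma normc_ge0 (a : R[i]) : 0 <= ComplexField.Normc.normc a.
Proof. by case: a => ? ?; exact: sqrtr_ge0. Qed.

Lemma re_inner_sum_CS n (w : 'I_n -> R) (a b : 'I_n -> R[i]) : (forall i, 0 < w i) ->
  re_inner (\sum_i a i * b i) (\sum_i a i * b i) <=
  (\sum_i (w i)^-1 * re_inner (a i) (a i)) * (\sum_i w i * re_inner (b i) (b i)).
Proof.
move=> w0; rewrite -normc_sqrE.
pose p i := (Num.sqrt (w i))^-1 * ComplexField.Normc.normc (a i).
pose q i := Num.sqrt (w i) * ComplexField.Normc.normc (b i).
apply: (@le_trans _ _ ((\sum_i p i * q i) ^+ 2)).
  rewrite ler_sqr ?nnegrE ?normc_ge0//; last first.
    by apply: sumr_ge0 => i _; rewrite !mulr_ge0 ?normc_ge0 ?invr_ge0 ?sqrtr_ge0.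
  have -> : \sum_i p i * q i = \sum_i ComplexField.Normc.normc (a i * b i).
    apply: eq_bigr => i _; rewrite ComplexField.Normc.normcM /p /q mulrACA.
    by rewrite mulVf ?mul1r// gt_eqF// sqrtr_gt0.
  elim/big_ind2 : _ => [|u1 u2 v1 v2 h1 h2|i _]; rewrite ?ComplexField.Normc.normc0//.
  by apply: le_trans (le_normcD _ _) _; exact: lerD.
apply: le_trans (sum_CS p q) _; rewrite le_eqVlt; apply/orP; left; apply/eqP.
congr (_ * _); apply: eq_bigr => i _; rewrite exprMn normc_sqrE ?exprVn//.
  by rewrite sqr_sqrtr// ltW.
by rewrite sqr_sqrtr// ltW.
Qed.

Lemma le_of_le_add_small (s a b : R) : 0 <= a -> 0 <= b ->
  (forall d, 0 < d -> d <= 1 -> s <= a + d * b) -> s <= a.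
Proof.
move=> a0 b0 h; apply/ler_addgt0Pr => e e0.
have b1 : 0 < b + 1 by rewrite ltr_wpDl.
pose d := Num.min 1 (e / (b + 1)).
have d0 : 0 < d by rewrite lt_min ltr01 divr_gt0.
have d1 : d <= 1 by rewrite ge_min lexx.
apply: le_trans (h d d0 d1) _; rewrite lerD2l.
have : d <= e / (b + 1) by rewrite ge_min lexx orbT.
by rewrite ler_pdivlMr//; nra.
Qed.

(** On truncated sequences the weighted Cauchy-Schwarz inequality gives the bound directly. The tail
    is controlled by the possibly worse bound [D] coming from continuity, and disappears in the
    limit. *)
Lemma op_bound_matrix q x H : 0 <= H ->
  (forall N M, \sum_(j < N) s_weight q j *
    \sum_(i < M) s_weight q i * re_inner (L x (l2_basis j) i) (L x (l2_basis j) i) <=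
      H) ->
  op_bound q x H.
Proof.
move=> H0 h xi C hxi; have C0 := sqle_ge0 hxi.
have hN N : sqle (s_weight q) (x (trunc N xi)) (H * C).
  move=> M.
  apply: (@le_trans _ _ (\sum_(i < M) s_weight q i * (C *
      \sum_(j < N) s_weight q j * re_inner (L x (l2_basis j) i) (L x (l2_basis j) i)))).
    apply: ler_sum => i _; rewrite op_trunc ler_wpM2l ?s_weight_ge0//.
    apply: le_trans (re_inner_sum_CS (w := fun j : 'I_N => s_weight q j) _ _ _) _.
      by move=> j; exact: s_weight_gt0.
    rewrite ler_wpM2r ?hxi//; first by apply: sumr_ge0 => j _;
      rewrite mulr_ge0 ?s_weight_ge0 ?re_inner_ge0.
  rewrite mulrC; apply: (le_trans _ (ler_wpM2l C0 (h N M))).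
  under eq_bigr do rewrite mulrCA mulr_sumr.
  rewrite -mulr_sumr exchange_big/=; under [in leRHS]eq_bigr do rewrite mulr_sumr.
  apply: ler_wpM2l => //; apply: ler_sum => j _; apply: ler_sum => i _.
  by rewrite mulrCA.
have [D D0 hD] := op_bound_exists q x.
move=> M; apply: (@le_of_le_add_small _ _ (H * C + 2 * D)).
- exact: mulr_ge0.
- by rewrite addr_ge0 ?mulr_ge0.
(* The tail is taken of size [d ^+ 2] because the Young inequality multiplies it by [1 + d^-1]. *)
move=> d d0 d1; have [N hN'] := trunc_tail (dual_weight_ge0 q) hxi (exprn_gt0 2 d0).
have e : x xi = x (trunc N xi) + x (xi - trunc N xi) by rewrite -opD addrC subrK.
have := sqle_Young (s_weight_ge0 q) d0 (hN N) (hD _ _ hN').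
rewrite e => /(_ M) /le_trans; apply.
have -> : (1 + d^-1) * (D * d ^+ 2) = (d ^+ 2 + d) * D by field; rewrite gt_eqF.
have : d ^+ 2 * D <= d * D by rewrite ler_wpM2r// expr2 ler_piMr// ltW.
nra.
Qed.

End HilbertSchmidtBound.

(** * Completeness and sequential convergence *)

Section Completeness.
Context {R : realType}.
Local Open Scope complex_scope.
Implicit Types (x y : smooth_op R) (X : nat -> smooth_op R) (xi : sdual R).

Lemma cvg_of_cauchy (f : nat -> R) :
  (forall e, 0 < e -> exists N, forall n m, (N <= n)%N -> (N <= m)%N ->
     (f n - f m) ^+ 2 <= e) -> cvgn f.
Proof.
move=> h; apply: cauchy_cvg; apply: cauchy_exP => e e0.
have e20 : 0 < e / 2 by rewrite divr_gt0.
have [N hN] := h _ (exprn_gt0 2 e20); exists (f N); exists N => // n /= Nn.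
rewrite /ball/=; apply: le_lt_trans (_ : e / 2 < e); last by lra.
by rewrite -ler_sqr ?nnegrE ?(ltW e20)// real_normK ?num_real// hN.
Qed.

(** [op_cvg_cvg] and [cvg_op_cvg] identify this with convergence in the topology of the norms
    [op_norm]. *)
Definition op_cvg X x : Prop :=
  forall q e, 0 < e -> exists N, forall n, (N <= n)%N -> op_bound q (X n - x) e.

Definition op_cauchy X : Prop := forall q e, 0 < e ->
  exists N, forall n m, (N <= n)%N -> (N <= m)%N -> op_bound q (X n - X m) e.

Lemma sqle_coord q (v : nat -> R[i]) C i : sqle (s_weight q) v C -> re_inner (v i) (v
  i) <= C.
Proof.
move=> /(_ i.+1); rewrite big_ord_recr/=; apply: le_trans.
apply: (@le_trans _ _ (s_weight q i * re_inner (v i) (v i))).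
  rewrite ler_peMl ?re_inner_ge0// exprn_ege1// ler1n//.
by rewrite lerDr sumr_ge0// => j _; rewrite mulr_ge0 ?s_weight_ge0 ?re_inner_ge0.
Qed.

Section Limit.
Variable X : nat -> smooth_op R.
Hypothesis XC : op_cauchy X.

Let coord_cauchy xi i e : 0 < e -> exists N, forall n m, (N <= n)%N ->
  (N <= m)%N -> re_inner (X n xi i - X m xi i) (X n xi i - X m xi i) <= e.
Proof.
move=> e0; have [q [C hC]] := sdual_sqle xi; have C0 := sqle_ge0 hC.
have C1 : 0 < C + 1 by rewrite ltr_wpDl.
have [N hN] := XC q (divr_gt0 e0 C1); exists N => n m Nn Nm.
have := sqle_coord i (hN n m Nn Nm _ _ hC).
rewrite -[_ i]/(X n xi i - X m xi i) => /le_trans; apply.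
by rewrite mulrAC ler_pdivrMr//; nra.
Qed.

Let limc xi i : R[i] := limn (fun n => complex.Re (X n xi i)) +i*
  limn (fun n => complex.Im (X n xi i)).

Let cvgRe xi i : (fun n => complex.Re (X n xi i)) @ \oo --> complex.Re (limc xi i).
Proof.
apply: cvg_of_cauchy => e /(coord_cauchy xi i)[N hN]; exists N => n m Nn Nm.
apply: le_trans (hN n m Nn Nm); case: (X n xi i) (X m xi i) => [a b] [c d].
by rewrite /re_inner/= -!expr2 lerDl sqr_ge0.
Qed.

Let cvgIm xi i : (fun n => complex.Im (X n xi i)) @ \oo --> complex.Im (limc xi i).
Proof.
apply: cvg_of_cauchy => e /(coord_cauchy xi i)[N hN]; exists N => n m Nn Nm.
apply: le_trans (hN n m Nn Nm); case: (X n xi i) (X m xi i) => [a b] [c d].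
by rewrite /re_inner/= -!expr2 lerDr sqr_ge0.
Qed.

Let cvg_cre xi i (a : R[i]) : (fun n => re_inner (a - X n xi i) (a - X n xi i)) @ \oo -->
  re_inner (a - limc xi i) (a - limc xi i).
Proof.
have h (z : R[i]) : re_inner (a - z) (a - z) =
    (complex.Re a - complex.Re z) ^+ 2 + (complex.Im a - complex.Im z) ^+ 2.
  by case: a z => [? ?] [? ?]; rewrite /re_inner/= -!expr2.
rewrite h (_ : (fun _ => _) = fun n =>
  (complex.Re a - complex.Re (X n xi i)) ^+ 2 +
  (complex.Im a - complex.Im (X n xi i)) ^+ 2); last by apply/funext => n; exact: h.
have hR : (fun n => complex.Re a - complex.Re (X n xi i)) @ \oo -->
    complex.Re a - complex.Re (limc xi i) by apply: cvgB; [exact: cvg_cst|exact: cvgRe].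
have hI : (fun n => complex.Im a - complex.Im (X n xi i)) @ \oo -->
    complex.Im a - complex.Im (limc xi i) by apply: cvgB; [exact: cvg_cst|exact: cvgIm].
exact: cvgD (cvgM hR hR) (cvgM hI hI).
Qed.

(** On finitely many coordinates the estimate between [X n] and [X m] passes to the limit in [m],
    and partial sums are all that [sqle] asks for. *)
Let fatou q e N xi C n : (forall n m, (N <= n)%N -> (N <= m)%N -> op_bound q (X n - X
  m) e) ->
  sqle (dual_weight q) xi C -> (N <= n)%N -> sqle (s_weight q) (s_val (X n xi) - limc
    xi) (e * C).
Proof.
move=> hN hC Nn M.
pose F m := \sum_(i < M) s_weight q i * re_inner (X n xi i - X m xi i) (X n xi i - X m
  xi i).
have cF : F @ \oo --> \sum_(i < M) s_weight q i * re_inner (X n xi i - limc xi i) (X n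
  xi i - limc xi i).
  rewrite /F; elim: M {F} => [|M IH].
    by under eq_fun do rewrite big_ord0; rewrite big_ord0; exact: cvg_cst.
  under eq_fun do rewrite big_ord_recr/=; rewrite big_ord_recr/=.
  by apply: cvgD => //; apply: cvgM; [exact: cvg_cst|exact: cvg_cre].
rewrite -[leLHS](cvg_lim _ cF)//; apply: limr_le.
  by apply/cvg_ex; eexists; exact: cF.
by exists N => // m Nm; exact: hN n m Nn Nm _ _ hC M.
Qed.

Let limc_in_s xi : limc xi \in in_s.
Proof.
apply/in_sE => q; have [q0 [C hC]] := sdual_sqle xi.
(* The index [maxn q q0] serves both the dual norm that is finite at [xi] and the norm on [s] to be
   bounded. *)
have hC' : sqle (dual_weight (maxn q q0)) xi C.
  by apply: sqle_weight hC => j; apply: le_dual_weight; exact: leq_maxr.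
have [N hN] := XC (maxn q q0) ltr01.
have h1 := fatou hN hC' (leqnn N).
have [D D0 /(_ _ _ hC') h2] := op_bound_exists (maxn q q0) (X N).
have h3 := sqleD (s_weight_ge0 (maxn q q0)) h2 (sqleZ (-1) h1).
eexists; apply: sqle_weight; first by move=> j; apply: le_s_weight;
  exact: (leq_maxl q q0).
rewrite (_ : limc xi = s_val (X N xi) + -1 *: (s_val (X N xi) - limc xi)).
  exact: h3.
by rewrite scaleN1r opprB addrC subrK.
Qed.

Let lim_fun xi : s R := S (limc_in_s xi).

Let lim_linear : linear lim_fun.
Proof.
move=> a xi eta; apply/val_inj/funext => i.
rewrite -[LHS]/(limc _ i) -[RHS]/(a * limc xi i + limc eta i).
have hX n : X n (a *: xi + eta) i = a * X n xi i + X n eta i by rewrite op_linear.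
have e1 : complex.Re (limc (a *: xi + eta) i) =
    complex.Re a * complex.Re (limc xi i) - complex.Im a * complex.Im (limc xi i) +
      complex.Re (limc eta i).
  apply: cvg_lim => //; rewrite (_ : (fun _ => _) = fun n =>
    complex.Re a * complex.Re (X n xi i) - complex.Im a * complex.Im (X n xi i) +
      complex.Re (X n eta i)).
    apply: cvgD; last exact: cvgRe.
    by apply: cvgB; (apply: cvgM; first exact: cvg_cst); [exact: cvgRe|exact: cvgIm].
  apply/funext => n; rewrite hX; case: (a) (X n xi i) (X n eta i) =>
    [? ?] [? ?] [? ?] //=.
have e2 : complex.Im (limc (a *: xi + eta) i) =
    complex.Re a * complex.Im (limc xi i) + complex.Im a * complex.Re (limc xi i) +
      complex.Im (limc eta i).
  apply: cvg_lim => //; rewrite (_ : (fun _ => _) = fun n =>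
    complex.Re a * complex.Im (X n xi i) + complex.Im a * complex.Re (X n xi i) +
      complex.Im (X n eta i)).
    apply: cvgD; last exact: cvgIm.
    by apply: cvgD; (apply: cvgM; first exact: cvg_cst); [exact: cvgIm|exact: cvgRe].
  apply/funext => n; rewrite hX; case: (a) (X n xi i) (X n eta i) =>
    [? ?] [? ?] [? ?] //=.
apply/eqP; rewrite eq_complex e1 e2; move: (limc xi i) (limc eta i) => z w.
by case: (a) z w => [? ?] [? ?] [? ?] /=; rewrite !eqxx.
Qed.

Lemma op_cauchy_cvg : exists x, op_cvg X x.
Proof.
have lb q e : 0 < e -> exists N, forall n, (N <= n)%N ->
    op_bound q (fun xi => X n xi - lim_fun xi) e.
  by move=> /(XC q)[N hN]; exists N => n Nn xi C hC; exact: fatou hN hC Nn.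
have smo : lim_fun \in is_smooth_op.
  apply: smooth_op_of_bound; first exact: lim_linear.
  move=> q; have [N /(_ N (leqnn N)) hN] := lb q _ ltr01.
  have [D D0 hD] := op_bound_exists q (X N).
  exists (2 * (D + 1)); first by rewrite mulr_ge0// addr_ge0.
  move=> xi C hC; have := sqleD (s_weight_ge0 q) (hD _ _ hC) (sqleZ (-1) (hN _ _ hC)).
  rewrite (_ : s_val (lim_fun xi) = s_val (X N xi) + -1 *: (s_val (X N xi) - limc xi)).
    apply: sqle_le; rewrite /re_inner/= oppr0 mulr0 addr0 mulrNN mulr1 !mul1r; lra.
  by rewrite scaleN1r opprB addrC subrK.
by exists (SmoothOp smo) => q e /(lb q)[N hN]; exists N.
Qed.

End Limit.

Lemma op_cvg_cvg X x : op_cvg X x -> X @ \oo --> x.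
Proof.
move=> h U; rewrite nbhsE => -[V [oV Vx] VU].
have {}oV : norm_open (@op_norm R) V by [].
have [n [e [e0 he]]] := oV _ Vx.
have e20 : 0 < (e / 2) ^+ 2 by rewrite exprn_gt0// divr_gt0.
(* A basic neighbourhood constrains only the norms up to [n], so the finitely many thresholds have a
   maximum. *)
have [N hN] : exists N, forall m, (N <= m)%N -> forall k, (k <= n)%N ->
    op_bound k (X m - x) ((e / 2) ^+ 2).
  elim: n {he} => [|n [N IH]].
    have [N hN] := h 0%N _ e20; exists N => m Nm k; rewrite leqn0 => /eqP ->.
    exact: hN.
  have [N' hN'] := h n.+1 _ e20; exists (maxn N N') => m;
    rewrite geq_max => /andP[Nm Nm'] k.
  by rewrite leq_eqVlt => /predU1P[->|]; [exact: hN'|exact: IH].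
exists N => // m /= Nm; apply: VU.
have -> : X m = x + (X m - x) by rewrite addrC subrK.
apply: he => k kn; refine (op_bound_norm_lt e0 _ (ltW e20) (hN m Nm k kn)).
by rewrite exprMn; have := exprn_gt0 2 e0; lra.
Qed.

Lemma cvg_op_cvg X x : X @ \oo --> x -> op_cvg X x.
Proof.
(* Asking for the bound at all small perturbations of [y] makes [U] open; the perturbation [z = 0]
   returns the bound itself. *)
move=> h q e e0; pose U : set (smooth_op R) := [set y | exists2 d : R, 0 < d & forall z,
  (op_norm q z < d%:E)%E -> op_bound q (y + z - x) e].
have oU : open U.
  suff : norm_open (@op_norm R) U by [].
  move=> y [d d0 hd]; have d4 : 0 < d / 4 by rewrite divr_gt0.
  exists q, (d / 4); split=> // y' /(_ q (leqnn q)) hy'; exists (d / 4) => // z hz.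
  rewrite -(addrA y); apply: hd.
  have h4 : op_bound q (y' + z) (2 * ((d / 4) ^+ 2 + (d / 4) ^+ 2)).
    exact: op_boundD (op_norm_lt_bound d4 hy') (op_norm_lt_bound d4 hz).
  refine (op_bound_norm_lt d0 _ _ h4); last by rewrite mulr_ge0// addr_ge0// sqr_ge0.
  by rewrite exprMn; have := exprn_gt0 2 d0; lra.
have Ux : U x.
  exists (Num.sqrt e) => [|z hz]; first by rewrite sqrtr_gt0.
  rewrite addrAC subrr add0r -[e]sqr_sqrtr ?ltW//; apply: op_norm_lt_bound => //.
  by rewrite sqrtr_gt0.
have /h[N _ hN] : nbhs x U by apply: open_nbhs_nbhs; split.
exists N => n Nn; have [d d0 /(_ 0)] := hN n Nn; rewrite addr0; apply.
apply: (@op_bound_norm_lt _ _ _ 0) => //; first by rewrite exprn_gt0.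
move=> xi C hC M; rewrite big1 ?mul0r// => i _.
by rewrite /re_inner/= !mulr0 addr0 mulr0.
Qed.

Lemma closed_op_cvg (A : set (smooth_op R)) X x : closed A -> (forall n, A (X n)) ->
  op_cvg X x -> A x.
Proof.
move=> cA AX /op_cvg_cvg h; apply: cA => B /h[N _ hN].
by exists (X N); split=> //; apply: hN => /=.
Qed.

End Completeness.

(** * Hilbert-Schmidt norms *)

Section HilbertSchmidt.
Context {R : realType}.
Local Open Scope complex_scope.
Notation L := l2_restr.
Notation "x ** y" := (smooth_op_comp x y) (at level 40, left associativity).
Implicit Types (x y z : smooth_op R) (u v : l2 R) (X Y : nat -> smooth_op R).

Lemma s_weight0 j : s_weight 0 j = 1 :> R. Proof. by rewrite /s_weight muln0 expr0. Qed.
Lemma dual_weight0 j : dual_weight 0 j = 1 :> R. Proof. by rewrite /dual_weight muln0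
  expr0 invr1. Qed.

Lemma n2P u C : sqle (s_weight 0) u C <-> n2 u <= C.
Proof.
have e : (fun j => s_weight 0 j * re_inner (u j) (u j)) = (fun j => re_inner (u j) (u j)).
  by apply/funext => j; rewrite s_weight0 mul1r.
split=> [/(sqle_seriesP (s_weight_ge0 0))[_]|h]; first by rewrite e.
by apply/(sqle_seriesP (s_weight_ge0 0)); rewrite e; split=> //; exact: cvg_l2.
Qed.

Lemma op_bound_n2 x D u : op_bound 0 x D -> n2 (L x u) <= D * n2 u.
Proof.
move=> h; apply/n2P; apply: (h (l2_to_sdual u)).
apply: (@sqle_weight _ _ (s_weight 0)); last exact/n2P.
by move=> j; rewrite s_weight0 dual_weight0.
Qed.

(** A squared Hilbert-Schmidt norm weighted in the column index only; the same quantity for the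
    adjoint weighs the row index. *)
Definition column_le q x (C : R) : Prop :=
  forall n, \sum_(j < n) s_weight q j * n2 (L x (l2_basis j)) <= C.

Lemma column_le_ge0 q x C : column_le q x C -> 0 <= C.
Proof. by move=> /(_ 0%N); rewrite big_ord0. Qed.

Lemma sum_inv_sqr_le n : \sum_(j < n) (j.+1%:R ^+ 2)^-1 <= 2 :> R.
Proof.
(* The telescoping majorant comes from [1 / a^2 <= 2 (1 / a - 1 / (a + 1))], valid for [a >= 1]. *)
suff h : \sum_(j < n) (j.+1%:R ^+ 2)^-1 <= 2 * (1 - n.+1%:R^-1) :> R.
  by apply: le_trans h _; rewrite ler_piMr// gerBl invr_ge0.
elim: n => [|n IH]; first by rewrite big_ord0 invr1 subrr mulr0.
rewrite big_ord_recr/=; apply: le_trans (lerD IH (lexx _)) _.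
set a : R := n.+1%:R; have a1 : 1 <= a by rewrite ler1n.
have -> : n.+2%:R = a + 1 :> R by rewrite /a -natr1.
have a0 : 0 < a by exact: lt_le_trans a1.
have b0 : 0 < a + 1 by rewrite addr_gt0.
rewrite -subr_ge0 (_ : _ - _ = (a - 1) / (a ^+ 2 * (a + 1))).
  by rewrite divr_ge0 ?subr_ge0// mulr_ge0 ?sqr_ge0// ltW.
by field; rewrite !gt_eqF.
Qed.

Lemma sqle_basis q j : sqle (dual_weight q) (l2_basis j : l2 R) (dual_weight q j).
Proof.
move=> n; have e i : dual_weight q i * re_inner (l2_basis j i) (l2_basis j i) = if i ==
  j then dual_weight q j else 0 :> R.
  rewrite -[l2_val (l2_basis j) i]/(basis_fun j i) /basis_fun; case: eqP => [->|_].
    by rewrite /re_inner/= mulr0 addr0 !mulr1.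
  by rewrite /re_inner/= mulr0 addr0 mulr0.
under eq_bigr do rewrite e.
rewrite -big_mkcond/= -(big_mkord (fun i => i == j) (fun=> dual_weight q j)).
have [jn|nj] := ltnP j n.
  rewrite (big_rem j) ?mem_index_iota//= eqxx big1_seq ?addr0// => i.
  by rewrite mem_rem_uniq ?iota_uniq// inE => /andP[/eqP -> /andP[]]; rewrite eqxx.
rewrite big1_seq ?dual_weight_ge0// => i /andP[/eqP ->].
by rewrite mem_index_iota ltnNge nj.
Qed.

(** Passing from [q] to [q + 1] gains the summable factor [(j + 1)^-2] in column [j]; hence every
    element of [L(s',s)] is Hilbert-Schmidt, even with column weights. *)
Lemma op_bound_column_le q x D : 0 <= D -> op_bound q.+1 x D -> column_le q x (2 * D).
Proof.
move=> D0 h n.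
apply: (@le_trans _ _ (\sum_(j < n) D * (j.+1%:R ^+ 2)^-1)); last first.
  by rewrite -mulr_sumr mulrC ler_wpM2r// sum_inv_sqr_le.
apply: ler_sum => j _.
have : n2 (L x (l2_basis j)) <= D * dual_weight q.+1 j.
  apply/n2P; apply: (@sqle_weight _ _ (s_weight q.+1)); first by move=> i;
    exact: le_s_weight.
  exact: (h (l2_to_sdual (l2_basis j))) (@sqle_basis q.+1 j).
move/(ler_wpM2l (s_weight_ge0 q j)) => /le_trans; apply.
rewrite mulrCA ler_wpM2l// /s_weight /dual_weight mulnS addnC exprD invfM mulrA mulfV
  ?mul1r//.
Qed.

Lemma column_le_exists q x : exists C, column_le q x C.
Proof.
have [D D0 hD] := op_bound_exists q.+1 x; exists (2 * D); exact: op_bound_column_le.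
Qed.

Lemma cvg_hs x : cvgn (series (fun j => n2 (L x (l2_basis j)))).
Proof.
have [C hC] := column_le_exists 0 x.
apply: nondecreasing_is_cvgn; first by apply: nondecreasing_series => *; exact: n2_ge0.
exists C => _ [n _ <-]; rewrite /series/= big_mkord.
by apply: le_trans (hC n); apply: ler_sum => j _; rewrite s_weight0 mul1r.
Qed.

Lemma rinner_abs u v : `|rinner u v| <= n2 u + n2 v.
Proof.
rewrite ler_norml; have := n2_ge0 (u - v); have := n2_ge0 (u + v).
rewrite n2B {1}/n2 rinnerDl !rinnerDr (rinnerC v u) -!/(n2 _).
have := n2_ge0 u; have := n2_ge0 v => *; apply/andP; split; lra.
Qed.

(* Real part of the Hilbert-Schmidt inner product; [hs] is the squared norm. *)
Definition hs_inner x y : R := tsum (fun j => rinner (L x (l2_basis j)) (L y (l2_basis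
  j))).
Definition hs x : R := hs_inner x x.

Lemma cvg_hs_inner x y : cvgn (series (fun j => rinner (L x (l2_basis j)) (L y
  (l2_basis j)))).
Proof.
apply: (@cvg_series_dominated _ _ (fun j => n2 (L x (l2_basis j)) + n2 (L y (l2_basis
  j)))).
  by move=> j; exact: rinner_abs.
by apply: cvg_tsumD; exact: cvg_hs.
Qed.

Lemma hs_innerC x y : hs_inner x y = hs_inner y x.
Proof. by congr tsum; apply/funext => j; rewrite rinnerC. Qed.

Lemma hs_innerDl x y z : hs_inner (x + y) z = hs_inner x z + hs_inner y z.
Proof.
rewrite /hs_inner -tsumD; [|exact: cvg_hs_inner|exact: cvg_hs_inner].
by congr tsum; apply/funext => j; rewrite L_add rinnerDl.
Qed.

Lemma hs_innerZl (t : R) x y : hs_inner (t%:C *: x) y = t * hs_inner x y.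
Proof.
rewrite /hs_inner -tsumZ; last exact: cvg_hs_inner.
by congr tsum; apply/funext => j; rewrite L_scale rinnerZl.
Qed.

Lemma hs_innerDr x y z : hs_inner z (x + y) = hs_inner z x + hs_inner z y.
Proof. by rewrite hs_innerC hs_innerDl !(hs_innerC z). Qed.

Lemma hs_innerZr (t : R) x y : hs_inner x (t%:C *: y) = t * hs_inner x y.
Proof. by rewrite hs_innerC hs_innerZl hs_innerC. Qed.

Lemma hs_inner_adjoint x y y' z : adjoint y y' -> hs_inner (y ** x) z = hs_inner x (y'
  ** z).
Proof. by move=> h; congr tsum; apply/funext => j; rewrite !L_comp h. Qed.

Lemma hs_ge0 x : 0 <= hs x.
Proof. by apply: tsum_ge0 => [j|]; [exact: n2_ge0|exact: cvg_hs]. Qed.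

Lemma hs_ge x j : n2 (L x (l2_basis j)) <= hs x.
Proof. by apply: (@tsum_ge _ (fun j => n2 (L x (l2_basis j)))) => [i|];
  [exact: n2_ge0|exact: cvg_hs]. Qed.

Lemma hs_inner_CS x y : hs_inner x y ^+ 2 <= hs x * hs y.
Proof.
apply: discriminant_le; first exact: hs_ge0.
move=> t; have := hs_ge0 (x + t%:C *: y).
rewrite /hs hs_innerDl !hs_innerDr !hs_innerZl !hs_innerZr (hs_innerC y x).
by congr (_ <= _); ring.
Qed.

Lemma hsB x y : hs (x - y) = hs x - 2 * hs_inner x y + hs y.
Proof.
have -> : x - y = x + (-1)%:C *: y by rewrite rmorphN1 scaleN1r.
by rewrite /hs hs_innerDl !hs_innerDr !hs_innerZl !hs_innerZr (hs_innerC y x); ring.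
Qed.

Lemma hsP x C : column_le 0 x C <-> hs x <= C.
Proof.
have e n : \sum_(j < n) s_weight 0 j * n2 (L x (l2_basis j)) = series (fun j =>
  n2 (L x (l2_basis j))) n.
  by rewrite /series/= big_mkord; apply: eq_bigr => j _; rewrite s_weight0 mul1r.
have nd : nondecreasing_seq (series (fun j => n2 (L x (l2_basis j)))).
  by apply: nondecreasing_series => *; exact: n2_ge0.
split=> h; last first.
  move=> n; rewrite e; apply: le_trans h; apply: nondecreasing_cvgn_le => //.
  exact: cvg_hs.
by apply: limr_le; [exact: cvg_hs|near=> n; rewrite -e].
Unshelve. all: by end_near. Qed.

(** Coordinate [i] of [x u] is the complex inner product of [u] with column [i] of [y], so the
    Cauchy-Schwarz inequality applies coordinatewise. *)
Lemma n2_adjoint x y u : adjoint x y -> n2 (L x u) <= n2 u * hs y.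
Proof.
move=> h; apply/n2P => M.
have /(_ M) hy := (hsP y (hs y)).2 (lexx _).
apply: le_trans (ler_wpM2l (n2_ge0 u) hy); rewrite mulr_sumr; apply: ler_sum => i _.
rewrite s_weight0 !mul1r; set a := L x u i; set c := re_inner a a.
have c0 : 0 <= c by exact: re_inner_ge0.
(* Scaling the column by the coordinate [a] makes [|a|^2] a real inner product; one factor [c] is
   cancelled afterwards. *)
have e : c = rinner u (a *: L y (l2_basis i)) by rewrite -L_scaler -h rinner_basis.
have := rinner_CS u (a *: L y (l2_basis i)); rewrite -e n2Z -/c mulrCA expr2.
have [c00|cn0] := eqVneq c 0; first by rewrite c00 mulr_ge0 ?n2_ge0.
by rewrite ler_pM2l// lt_neqAle eq_sym cn0.
Qed.

Lemma column_le_mul q x y C K : 0 <= K -> (forall u, n2 (L x u) <= n2 u * K) ->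
  column_le q y C -> column_le q (x ** y) (C * K).
Proof.
move=> K0 hx hy n; apply: le_trans (ler_wpM2r K0 (hy n)); rewrite mulr_suml.
by apply: ler_sum => j _; rewrite -mulrA ler_wpM2l ?s_weight_ge0// L_comp.
Qed.

Lemma hs_comp x y : herm x -> hs (x ** y) <= hs y * hs x.
Proof.
move=> h; apply/hsP; apply: column_le_mul; first exact: hs_ge0.
  by move=> u; exact: n2_adjoint.
exact/hsP.
Qed.

Lemma column_leB q x y C D : column_le q x C -> column_le q y D ->
  column_le q (x - y) (2 * (C + D)).
Proof.
move=> hx hy n; apply: le_trans (ler_wpM2l _ (lerD (hx n) (hy n))) => //.
rewrite -big_split mulr_sumr/=; apply: ler_sum => j _.
rewrite -mulrDr mulrCA ler_wpM2l ?s_weight_ge0// L_sub.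
apply: le_trans (n2_D_le _ _) _; rewrite -scaleN1r n2Z /re_inner/= oppr0 mulr0 addr0.
by rewrite mulrNN mulr1 mul1r.
Qed.

(* Lets the Hilbert-Schmidt norm control the weighted norms of rapidly decaying
   matrices. *)
Lemma weight_interp (a b e : R) : 0 <= a -> 0 <= b -> 0 < e ->
  a * b <= e * (a ^+ 4 + b ^+ 4) + e^-1.
Proof.
move=> a0 b0 e0; have i0 : 0 < e^-1 by rewrite invr_gt0.
have h c : c ^+ 2 <= e * c ^+ 4 + e^-1 / 4.
  have : 0 <= e^-1 * (e * c ^+ 2 - 1 / 2) ^+ 2 by rewrite mulr_ge0 ?sqr_ge0// ltW.
  have -> : e^-1 * (e * c ^+ 2 - 1 / 2) ^+ 2 = e * c ^+ 4 - c ^+ 2 + e^-1 / 4.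
    by field; rewrite gt_eqF.
  lra.
have := h a; have := h b; have := sqr_ge0 (a - b); rewrite sqrrB; nra.
Qed.

Lemma n2_partial u M : \sum_(i < M) re_inner (u i) (u i) <= n2 u.
Proof.
have /(_ M) := (n2P u (n2 u)).2 (lexx _); apply: le_trans.
by apply: ler_sum => i _; rewrite s_weight0 mul1r.
Qed.

(** After [weight_interp] the double sum splits into three: the term weighted in [j] is a column sum
    of [x], the term weighted in [i] is one of [y] by transposition, and the unweighted term is at
    most [hs x]. The fourth powers account for the index [4 * q]. *)
Lemma adjoint_op_bound q x y C D e : adjoint x y -> 0 < e -> column_le (4 * q) x C ->
  column_le (4 * q) y C -> hs x <= D -> op_bound q x (e * (C + C) + e^-1 * D).
Proof.
move=> xy e0 hx hy /hsP hD; have i0 : 0 < e^-1 by rewrite invr_gt0.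
have C0 := column_le_ge0 hx; have D0 := column_le_ge0 hD.
have w4 i : s_weight q i ^+ 4 = s_weight (4 * q) i :> R.
  by rewrite /s_weight -exprM; congr (_ ^+ _); lia.
apply: op_bound_matrix; first by rewrite addr_ge0// mulr_ge0 ?addr_ge0// ltW.
move=> N M; pose c j i := re_inner (L x (l2_basis j) i) (L x (l2_basis j) i).
have c0 j i : 0 <= c j i by exact: re_inner_ge0.
apply: (@le_trans _ _ (\sum_(j < N) \sum_(i < M)
   (e * (s_weight (4 * q) i * c j i + s_weight (4 * q) j * c j i) + e^-1 * c j i))).
  apply: ler_sum => j _; rewrite mulr_sumr; apply: ler_sum => i _.
  rewrite mulrA -/(c j i) -mulrDl mulrA -mulrDl ler_wpM2r//.
  by have := weight_interp (s_weight_ge0 q j) (s_weight_ge0 q i) e0;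
    rewrite !w4 [X in e * X]addrC.
under eq_bigr do rewrite big_split/= -!mulr_sumr big_split/=.
rewrite big_split/= -!mulr_sumr big_split/=.
apply: lerD; last first.
  rewrite ler_wpM2l ?(ltW i0)//; apply: le_trans (hD N); apply: ler_sum => j _.
  by rewrite s_weight0 mul1r n2_partial.
rewrite ler_wpM2l ?(ltW e0)//; apply: lerD.
  rewrite exchange_big/=; apply: le_trans (hy M); apply: ler_sum => i _.
  rewrite -mulr_sumr ler_wpM2l ?s_weight_ge0//; apply: le_trans (n2_partial _ N).
  by apply: ler_sum => j _; rewrite /c (adjoint_entry _ _ xy).
apply: le_trans (hx N); apply: ler_sum => j _.
by rewrite -mulr_sumr ler_wpM2l ?s_weight_ge0// n2_partial.
Qed.

Lemma hs_op_cauchy X Y : (forall n, adjoint (X n) (Y n)) ->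
  (forall q, exists C, forall n, column_le q (X n) C /\ column_le q (Y n) C) ->
  (forall e, 0 < e -> exists N, forall n m, (N <= n)%N -> (N <= m)%N ->
     hs (X n - X m) <= e) ->
  op_cauchy X.
Proof.
move=> XY bd hc q e e0; have [C hC] := bd (4 * q)%N.
have C0 : 0 <= C by have [h _] := hC 0%N; exact: column_le_ge0 h.
(* Differences have column bounds [4 C], so the weighted part contributes at most [8 C d <= e / 2];
   the threshold [d * (e / 2)] for [hs] makes the other part [e / 2]. *)
pose d := e / (8 * C + 1) / 2.
have c1 : 0 < 8 * C + 1 by rewrite ltr_wpDl// mulr_ge0.
have d0 : 0 < d by rewrite !divr_gt0.
have [N hN] := hc _ (mulr_gt0 d0 (divr_gt0 e0 (ltr0Sn _ 1))).
exists N => n m Nn Nm.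
have [hX1 hY1] := hC n; have [hX2 hY2] := hC m.
have := adjoint_op_bound (adjointB (XY n) (XY m)) d0 (column_leB hX1 hX2) (column_leB
  hY1 hY2) (hN n m Nn Nm).
apply: op_bound_le; rewrite mulKf ?gt_eqF//.
have : d * (8 * C + 1) = e / 2 by rewrite /d; field; rewrite gt_eqF.
nra.
Qed.

(** The matrix determines the operator on all of [s'], since [op_bound_matrix] turns zero entries
    into the bound 0. *)
Lemma L_eq0 x : (forall j, L x (l2_basis j) = 0) -> x = 0.
Proof.
move=> h; apply/val_inj/funext => xi; apply/val_inj/funext => i.
have [q [C hC]] := sdual_sqle xi.
have : op_bound q x 0.
  apply: op_bound_matrix => // N M; rewrite big1// => j _; rewrite big1 ?mulr0// => k _.
  by rewrite h /re_inner/= !mulr0 addr0 mulr0.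
move=> /(_ _ _ hC) /(@sqle_coord _ _ _ _ i); rewrite mul0r => h0.
by apply/eqP; rewrite -re_inner_eq0 eq_le h0 re_inner_ge0.
Qed.

Lemma L_inj x y : (forall u, L x u = L y u) -> x = y.
Proof.
by move=> h; apply/eqP; rewrite -subr_eq0; apply/eqP/L_eq0 => j; rewrite L_sub h subrr.
Qed.

Lemma hs_eq0 x : hs x = 0 -> x = 0.
Proof.
move=> h; apply: L_eq0 => j; apply: n2_eq0; apply/eqP.
by rewrite eq_le n2_ge0 andbT -h hs_ge.
Qed.

End HilbertSchmidt.

(** * Spectral projections *)

Section SubmultiplicativeSequence.
Context {R : realType}.
Variable b : nat -> R.
Hypothesis b_gt0 : forall n, 0 < b n.
Hypothesis b_logconvex : forall n, b n.+1 ^+ 2 <= b n * b n.+2.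
Hypothesis b_submul : forall n m, b (n + m).+1 <= b n * b m.

(* For [b n = ||y^(n+1)||_HS^2] this [r] is the square of the spectral radius. *)
Lemma growth_rate : exists2 r, 0 < r &
  nonincreasing_seq (fun n => b n / r ^+ n.+1) /\ forall n, 1 <= b n / r ^+ n.+1.
Proof.
(* Log-convexity makes the ratios increase and submultiplicativity bounds them by [b 0]; [r] is
   their limit. *)
pose rho n := b n.+1 / b n.
have rho0 n : 0 < rho n by rewrite divr_gt0.
have nd : nondecreasing_seq rho.
  apply/nondecreasing_seqP => n; rewrite ler_pdivrMr// mulrAC ler_pdivlMr//.
  by rewrite -expr2 mulrC b_logconvex.
have ub n : rho n <= b 0 by rewrite ler_pdivrMr// -[n in leLHS]add0n b_submul.
have cr : cvgn rho by apply: nondecreasing_is_cvgn => //; exists (b 0) => _ [n _ <-].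
pose r := limn rho.
have rr n : rho n <= r by exact: nondecreasing_cvgn_le.
have r0 : 0 < r by exact: lt_le_trans (rho0 0%N) (rr 0%N).
exists r => //; split.
  apply/nonincreasing_seqP => n; rewrite [r ^+ n.+2]exprS invfM mulrA ler_wpM2r//.
    by rewrite invr_ge0 exprn_ge0// ltW.
  by rewrite ler_pdivrMr// mulrC -ler_pdivrMr// rr.
move=> n; rewrite ler_pdivlMr ?exprn_gt0// mul1r.
(* Ratios beyond [m] are at least [rho m]. For [k = n + 1], submultiplicativity bounds the right
   side by [b n * b m]; cancelling [b m] and letting [m] grow gives [r ^+ n.+1 <= b n]. *)
have h m k : rho m ^+ k * b m <= b (k + m)%N.
  elim: k => [|k IH]; first by rewrite expr0 mul1r.
  rewrite exprS -mulrA; apply: le_trans (ler_wpM2l (ltW (rho0 m)) IH) _.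
  rewrite addSn -ler_pdivlMr//; exact: nd (leq_addl _ _).
have h2 m : rho m ^+ n.+1 <= b n.
  by rewrite -(ler_pM2r (b_gt0 m)); apply: le_trans (h m n.+1) _; rewrite addSn b_submul.
have c : (fun m => rho m ^+ n.+1) @ \oo --> r ^+ n.+1.
  elim: n.+1 => [|k IH]; first by under eq_fun do rewrite expr0; exact: cvg_cst.
  by under eq_fun do rewrite exprS; rewrite exprS; exact: cvgM cr IH.
rewrite -(cvg_lim _ c)//; apply: limr_le; last by near=> m.
by apply/cvg_ex; eexists; exact: c.
Unshelve. all: by end_near. Qed.

End SubmultiplicativeSequence.

(** * Pointwise limits on [l2] *)

Section StrongLimits.
Context {R : realType}.
Local Open Scope complex_scope.
Notation L := l2_restr.
Implicit Types (x y z : smooth_op R) (u v w : l2 R) (f : nat -> l2 R).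

Definition l2_cvg f v := forall e : R, 0 < e ->
  exists N, forall n, (N <= n)%N -> n2 (f n - v) <= e.

Lemma l2_cvg_unique f v w : l2_cvg f v -> l2_cvg f w -> v = w.
Proof.
move=> hv hw; apply/eqP; rewrite -subr_eq0; apply/eqP/n2_eq0/eqP.
rewrite eq_le n2_ge0 andbT; apply/ler_addgt0Pr => e e0; rewrite add0r.
have e4 : 0 < e / 4 by rewrite divr_gt0.
have [N /(_ (maxn N _) (leq_maxl _ _)) hN] := hv _ e4.
have [M /(_ (maxn N M) (leq_maxr _ _)) hM] := hw _ e4.
have -> : v - w = (-1)%:C *: (f (maxn N M) - v) + (f (maxn N M) - w).
  by rewrite rmorphN1 scaleN1r opprB addrA subrK.
apply: le_trans (n2_D_le _ _) _; rewrite n2Z.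
have := hN M; rewrite /re_inner/= mulr0 addr0 mulrNN mulr1 mul1r; lra.
Qed.

Lemma l2_cvg_cst v : l2_cvg (fun=> v) v.
Proof. by move=> e e0; exists 0%N => n _; rewrite subrr n2_0 ltW. Qed.

Lemma l2_cvg_op x f v : l2_cvg f v -> l2_cvg (fun n => L x (f n)) (L x v).
Proof.
move=> h e e0; have [D D0 hD] := op_bound_exists 0 x.
have D1 : 0 < D + 1 by rewrite ltr_wpDl.
have [N hN] := h _ (divr_gt0 e0 D1); exists N => n /hN {}hN.
rewrite -L_subr; apply: le_trans (op_bound_n2 _ hD) _.
apply: le_trans (ler_wpM2l D0 hN) _; rewrite mulrCA ler_piMr ?ltW//.
by rewrite ltr_pdivrMr// mul1r ltrDl.
Qed.

Lemma l2_cvg_scale a f v : l2_cvg f v -> l2_cvg (fun n => a *: f n) (a *: v).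
Proof.
move=> h e e0; have C0 := re_inner_ge0 a.
have C1 : 0 < re_inner a a + 1 by rewrite ltr_wpDl.
have [N hN] := h _ (divr_gt0 e0 C1); exists N => n /hN {}hN.
rewrite -scalerBr n2Z; apply: le_trans (ler_wpM2l C0 hN) _.
by rewrite mulrCA ler_piMr ?(ltW e0)// ler_pdivrMr// mul1r lerDl.
Qed.

Lemma l2_cvg_shift k f v : l2_cvg f v -> l2_cvg (fun n => f (k + n)%N) v.
Proof.
move=> h e /h[N hN]; exists N => n Nn; apply: hN; exact: leq_trans (leq_addl _ _).
Qed.

Lemma op_cvg_l2_cvg X x u : op_cvg X x -> l2_cvg (fun n => L (X n) u) (L x u).
Proof.
move=> h e e0; have C1 : 0 < n2 u + 1 by rewrite ltr_wpDl// n2_ge0.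
have [N hN] := h 0%N _ (divr_gt0 e0 C1); exists N => n /hN {}hN.
rewrite -L_sub; apply: le_trans (op_bound_n2 _ hN) _.
by rewrite mulrAC ler_pdivrMr// ler_pM2l// lerDl.
Qed.

Lemma herm_op_cvg X x : (forall n, herm (X n)) -> op_cvg X x -> herm x.
Proof.
move=> hX h u v; have hu := op_cvg_l2_cvg u h; have hv := op_cvg_l2_cvg v h.
apply/eqP; rewrite -subr_eq0 -sqrf_eq0 eq_le sqr_ge0 andbT.
apply/ler_addgt0Pr => e e0; rewrite add0r.
have C1 : 0 < n2 u + n2 v + 1 by rewrite ltr_wpDl// addr_ge0 ?n2_ge0.
have e2 : 0 < e / (n2 u + n2 v + 1) / 2 by rewrite !divr_gt0.
have [N hN] := hu _ e2; have [M hM] := hv _ e2.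
have {}hN := hN (maxn N M) (leq_maxl _ _).
have {}hM := hM (maxn N M) (leq_maxr _ _).
set n := maxn N M in hN hM.
(* Self-adjointness of [X n] cancels the main terms and leaves two approximation errors, small by
   the Cauchy-Schwarz inequality. *)
have -> : rinner (L x u) v - rinner u (L x v) =
    rinner u (L (X n) v - L x v) - rinner (L (X n) u - L x u) v.
  by rewrite rinnerBl rinnerBr hX; ring.
have h1 := le_trans (rinner_CS _ _) (ler_wpM2r (n2_ge0 v) hN).
have h2 := le_trans (rinner_CS _ _) (ler_wpM2l (n2_ge0 u) hM).
have := sqr_ge0 (rinner u (L (X n) v - L x v) + rinner (L (X n) u - L x u) v).
set p := rinner u _ in h2 *; set q := rinner _ v in h1 *.
have : e / (n2 u + n2 v + 1) / 2 * (n2 u + n2 v + 1) = e / 2.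
  by field; rewrite gt_eqF.
move: h1 h2 e2; set d := _ / _ / _; rewrite sqrrD sqrrB; nra.
Qed.

End StrongLimits.

Section SpectralProjection.
Context {R : realType}.
Local Open Scope complex_scope.
Notation L := l2_restr.
Notation "x ** y" := (smooth_op_comp x y) (at level 40, left associativity).
Implicit Types (x y z : smooth_op R) (u v w : l2 R).

Section Powers.
Variable y : smooth_op R.
Hypothesis hy : herm y.

(** This is [y^(n+1)]: the algebra has no unit, so exponents start at 1. *)
Definition power n : smooth_op R := iter n (smooth_op_comp y) y.

Lemma L_power n u : L (power n) u = iter n.+1 (L y) u.
Proof. by elim: n => [//|n IH]; rewrite /power iterS L_comp -/(power n) IH. Qed.

Lemma herm_iter n u v : rinner (iter n (L y) u) v = rinner u (iter n (L y) v).
Proof. by elim: n u v => [//|n IH] u v; rewrite iterS hy IH -iterSr. Qed.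

(** Self-adjointness moves one factor across at a time, so the Gram matrix of the powers is a Hankel
    matrix; its Cauchy-Schwarz inequality is the log-convexity used below. *)
Lemma hs_inner_power n m : hs_inner (power n) (power m) = hs_inner (power (n + m))
  (power 0).
Proof.
elim: m n => [|m IH] n; first by rewrite addn0.
by rewrite addnS -addSn -IH [power n.+1]iterS (hs_inner_adjoint _ _ hy) -iterS.
Qed.

Lemma hs_power_gt0 n : y != 0 -> 0 < hs (power n).
Proof.
move=> y0; rewrite lt_neqAle hs_ge0 andbT eq_sym; apply/negP => /eqP/hs_eq0 e.
(* Since [||y^(k+1) u||^2 = <y^k u, y^(k+2) u>], vanishing descends from exponent [k + 2] to
   [k + 1]. *)
have iter_eq0 k u : iter k.+1 (L y) u = 0 -> L y u = 0.
  elim/ltn_ind: k u => -[//|k] IH u h.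
  have h2 : iter k.+1 (L y) u = 0.
    apply: n2_eq0; rewrite /n2 {1}iterS hy -iterS h.
    by rewrite rinnerC rinner0l.
  exact: IH h2.
case/negP: y0; apply/eqP/L_inj => u; rewrite L_zero.
by apply: (iter_eq0 n); rewrite -L_power e L_zero.
Qed.

End Powers.

(* The projection is the limit of [(y^2 / r)^n], [r] the square of the spectral
   radius of [y]. *)
Lemma spectral_projection (A : set (smooth_op R)) y : subalgebra A -> closed A ->
  A y -> herm y -> y != 0 ->
  exists2 r : R, 0 < r & exists Q, [/\ A Q, Q != 0, herm Q,
    forall u, L Q (L Q u) = L Q u & forall u, L y (L y (L Q u)) = r%:C *: L Q u].
Proof.
move=> [[sA0 sAD] AM] cA Ay hy y0.
have AZ a x : A x -> A (a *: x).
  by move=> Ax; rewrite -[_ *: _]addr0; apply: set_mem; apply: sAD => //; exact: mem_set.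
have Apw n : A (power y n) by elim: n => [//|n IH]; rewrite /power iterS; exact: AM.
pose b n := hs (power y n).
have b0 n : 0 < b n by exact: hs_power_gt0.
have bE n m k : (n + m = k.*2)%N -> hs_inner (power y n) (power y m) = b k.
  by move=> e; rewrite hs_inner_power// e -addnn -hs_inner_power.
have blog n : b n.+1 ^+ 2 <= b n * b n.+2.
  by rewrite -(bE n n.+2 n.+1) ?hs_inner_CS//; lia.
have bsub n m : b (n + m).+1 <= b n * b m.
  rewrite /b; have -> : power y (n + m).+1 = power y m ** power y n.
    by apply: L_inj => u; rewrite L_comp !L_power -iterD addnS addSn addnC.
  by apply: hs_comp => u v; rewrite !L_power herm_iter.
have [r r0 [gni g1]] := growth_rate b0 blog bsub.
exists r => //; set g := fun n => _ in gni g1.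
have cg : cvgn g by apply: nonincreasing_is_cvgn => //; exists 1 => _ [n _ <-]; exact: g1.
(* This is [(y^2 / r)^(n+1)]: the index [n.*2.+1] of [power] stands for the exponent [2 n + 2]. *)
pose z n := (r^-1 ^+ n.+1)%:C *: power y n.*2.+1.
have Lz n u : L (z n) u = (r^-1 ^+ n.+1)%:C *: iter n.*2.+2 (L y) u by rewrite L_scale
  L_power.
have iterZ n a u : iter n (L y) (a *: u) = a *: iter n (L y) u.
  by elim: n => [//|n IH]; rewrite !iterS IH L_scaler.
have hz n : herm (z n) by move=> u v; rewrite !Lz rinnerZl rinnerZr herm_iter.
have hipz n m : hs_inner (z n) (z m) = g (n + m).+1.
  rewrite hs_innerZl hs_innerZr (bE _ _ (n + m).+1); last by lia.
  rewrite mulrA -exprD mulrC exprVn.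
  by have -> : (n.+1 + m.+1 = (n + m).+2)%N by lia.
have zM n m u : L (z n) (L (z m) u) = L (z (n + m).+1) u.
  rewrite !Lz iterZ scalerA -rmorphM -exprD -iterD.
  have -> : (n.+1 + m.+1 = (n + m).+2)%N by lia.
  by have -> : (n.*2.+2 + m.*2.+2 = (n + m).+1.*2.+2)%N by lia.
have zC : op_cauchy z.
  apply: (@hs_op_cauchy _ z z) => [//|q|e e0].
    have [C hC] := column_le_exists q (z 0%N); have C0 := column_le_ge0 hC.
    have g10 : 0 <= g 1%N by apply: le_trans (g1 _).
    (* The columns of [z n.+1] are the images under [z n] of those of [z 0], and the squared norm of
       [z n] is at most [hs (z n) <= g 1]; the case of [z 0] uses [g 1 >= 1]. *)
    exists (C * g 1%N) => n; suff h : column_le q (z n) (C * g 1%N) by split.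
    case: n => [|n].
      by move=> k; apply: le_trans (hC k) _; rewrite ler_peMr//; exact: (g1 1%N).
    have -> : z n.+1 = z n ** z 0%N by apply: L_inj => u; rewrite L_comp zM addn0.
    apply: column_le_mul => // u; apply: le_trans (n2_adjoint _ (hz n)) _.
    rewrite ler_wpM2l ?n2_ge0// /hs hipz; exact: gni.
  have e4 : 0 < e / 4 by rewrite divr_gt0.
  move/cvgrPdist_lt : (cg) => /(_ _ e4)[N _ hN]; exists N => n m Nn Nm.
  rewrite hsB /hs !hipz.
  have [h1 h2 h3] : [/\ `|limn g - g (n + n).+1| < e / 4,
      `|limn g - g (n + m).+1| < e / 4 & `|limn g - g (m + m).+1| < e / 4].
    by split; apply: hN => /=; lia.
  by move: h1 h2 h3; rewrite !ltr_norml => /andP[? ?] /andP[? ?] /andP[? ?]; lra.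
have [Q zQ] := op_cauchy_cvg zC.
have lQ u := op_cvg_l2_cvg u zQ.
exists Q; split.
- by apply: closed_op_cvg zQ => // n; exact: AZ.
(* If [Q] were 0, convergence at index 1 would give [hs (z N) <= 1 / 2], against [hs (z N) >= 1].
   The index is 1 because [op_bound_column_le] loses one. *)
- apply/eqP => Q0; have [N /(_ N (leqnn N))] := zQ 1%N (1 / 4) (divr_gt0 ltr01 (ltr0Sn
  _ 3)).
  rewrite Q0 subr0 => h.
  have /hsP : column_le 0 (z N) (2 * (1 / 4)) by apply: op_bound_column_le => //;
    rewrite divr_ge0.
  by rewrite /hs hipz; have := g1 (N + N).+1; rewrite -/(g _); lra.
- exact: herm_op_cvg zQ.
(* Multiplication by a fixed [z n] only shifts the sequence of powers, so it fixes the limit;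
   letting [n] grow gives idempotence. *)
- move=> u; have h n : L (z n) (L Q u) = L Q u.
    apply: (l2_cvg_unique (l2_cvg_op (z n) (lQ u))).
    by under eq_fun do rewrite zM; have := l2_cvg_shift n.+1 (lQ u);
      under eq_fun do rewrite addSn.
  by apply: (l2_cvg_unique (lQ (L Q u))); under eq_fun do rewrite h; exact: l2_cvg_cst.
- move=> u; apply: (l2_cvg_unique (l2_cvg_op y (l2_cvg_op y (lQ u)))).
  have e n : L y (L y (L (z n) u)) = r%:C *: L (z (1 + n)%N) u.
    rewrite add1n !Lz !L_scaler scalerA -rmorphM [r^-1 ^+ n.+2]exprS mulrA mulfV
      ?gt_eqF// mul1r.
    by rewrite doubleS !iterS.
  under eq_fun do rewrite e; exact: l2_cvg_scale (l2_cvg_shift 1 (lQ u)).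
Qed.

End SpectralProjection.

(** * Commutative algebras *)

Section Projections.
Context {R : realType}.
Local Open Scope complex_scope.
Notation L := l2_restr.
Notation "x ** y" := (smooth_op_comp x y) (at level 40, left associativity).
Implicit Types (x y P Q : smooth_op R) (u v : l2 R).

Definition idem P := forall u, L P (L P u) = L P u.

Lemma n2_proj P u : herm P -> idem P -> n2 (L P u) = rinner (L P u) u.
Proof. by move=> hP iP; rewrite /n2 -hP iP. Qed.

Lemma n2_proj_compl P u : herm P -> idem P -> n2 (u - L P u) = n2 u - n2 (L P u).
Proof. by move=> hP iP; rewrite n2B (rinnerC u) -n2_proj//; ring. Qed.

(** [P = P ** P] and submultiplicativity give [hs P <= hs P ^+ 2], and [hs P] is nonzero. *)
Lemma hs_proj_ge1 P : P != 0 -> herm P -> idem P -> 1 <= hs P.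
Proof.
move=> P0 hP iP; have e : P ** P = P by apply: L_inj => u; rewrite L_comp iP.
have h0 : 0 < hs P.
  by rewrite lt_neqAle hs_ge0 andbT eq_sym; apply: contra P0 => /eqP/hs_eq0/eqP.
by have := hs_comp P hP; rewrite e -[X in X <= _ -> _]mul1r ler_pM2r.
Qed.

(** Columnwise [<P e_j, Q e_j> = <Q P e_j, Q e_j> = |Q e_j|^2], so the cross term equals [hs Q]. *)
Lemma hs_proj_sub P Q : herm Q -> idem Q -> (forall v, L Q (L P v) = L Q v) ->
  hs (P - Q) = hs P - hs Q.
Proof.
move=> hQ iQ QP; have e : hs_inner P Q = hs Q.
  congr tsum; apply/funext => j; rewrite -[in LHS]QP -[in LHS]iQ -hQ QP//.
by rewrite hsB e; ring.
Qed.

Lemma adjoint_herm x y : adjoint x y -> herm (y ** x).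
Proof. by move=> h u v; rewrite !L_comp -h rinnerC -h rinnerC. Qed.

End Projections.

(** * Minimal projections of a commutative algebra *)

Section CommutativeAlgebra.
Context {R : realType}.
Local Open Scope complex_scope.
Local Notation ci := (Complex 0 1 : R[i]).
Notation L := l2_restr.
Notation "x ** y" := (smooth_op_comp x y) (at level 40, left associativity).
Implicit Types (x y d P Q : smooth_op R) (u v : l2 R).
Variable A : set (smooth_op R).
Hypothesis subA : subalgebra A.
Hypothesis comA : commutative_set A.
Notation M := (minimal_projections A).

Lemma subalgebra_lin a x y : A x -> A y -> A (a *: x + y).
Proof.
by move=> Ax Ay; apply: set_mem; apply: subA.1.2 => //; exact: mem_set.
Qed.

Lemma subalgebra0 : A 0. Proof. by apply: set_mem; exact: subA.1.1. Qed.

Lemma subalgebraZ a x : A x -> A (a *: x).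
Proof. by move=> Ax; rewrite -[_ *: _]addr0; apply: subalgebra_lin => //;
  exact: subalgebra0. Qed.

Lemma subalgebraD x y : A x -> A y -> A (x + y).
Proof. by move=> Ax Ay; rewrite -[x]scale1r; exact: subalgebra_lin. Qed.

Lemma subalgebraB x y : A x -> A y -> A (x - y).
Proof. by move=> Ax Ay; rewrite -scaleN1r addrC; exact: subalgebra_lin. Qed.

Lemma subalgebraM x y : A x -> A y -> A (x ** y). Proof. exact: subA.2. Qed.

Lemma L_commute x y u : A x -> A y -> L x (L y u) = L y (L x u).
Proof. by move=> Ax Ay; rewrite -!L_comp comA. Qed.

Lemma hermM x y : A x -> A y -> herm x -> herm y -> herm (x ** y).
Proof. by move=> Ax Ay hx hy u v; rewrite !L_comp hx hy L_commute. Qed.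

Lemma projectionsP P : projections A P <-> [/\ A P, P != 0, herm P & idem P].
Proof.
by split=> [[AP P0 /l2_projectionP[hP iP]]|[AP P0 hP iP]]; split=> //;
  exact/l2_projectionP.
Qed.

Lemma min_projectionP P : M P -> [/\ A P, P != 0, herm P & idem P].
Proof. by move=> [/projectionsP]. Qed.

Lemma min_eq P Q : M P -> projections A Q -> (forall u, L P (L Q u) = L Q u) -> Q = P.
Proof.
move=> [pP h] pQ PQ; apply: h => //; have [AP _ _ _] := (projectionsP P).1 pP.
have [AQ _ _ _] := (projectionsP Q).1 pQ.
by split; apply: L_inj => u; rewrite L_comp ?(L_commute _ AQ AP).
Qed.

(** The product [P ** Q] is 0 or a projection below both; in the second case minimality would
    identify it with [P] and with [Q]. *)
Lemma min_orth P Q u : M P -> M Q -> P <> Q -> L P (L Q u) = 0.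
Proof.
move=> mP mQ PQ; have [AP P0 hP iP] := min_projectionP mP;
  have [AQ Q0 hQ iQ] := min_projectionP mQ.
rewrite -L_comp; suff -> : P ** Q = 0 by rewrite L_zero.
apply: contrapT => n0; have pPQ : projections A (P ** Q).
  apply/projectionsP; split; [exact: subalgebraM|exact/eqP|exact: hermM|].
  by move=> v; rewrite !L_comp (L_commute (L Q v) AQ AP) iQ iP.
apply: PQ; rewrite -(min_eq mP pPQ); last by move=> v; rewrite L_comp iP.
by apply: min_eq => // v; rewrite L_comp (L_commute v AP AQ) iQ.
Qed.

(** Induction on an upper bound for [hs P]: a non-minimal [P] splits into [Q] and [P - Q], each with
    [hs] at least 1, so the bound for both parts drops by one. *)
Lemma projection_sum n P : projections A P -> hs P < n%:R ->
  exists2 s : seq (smooth_op R), (forall Q, Q \in s -> M Q) & P = \sum_(Q <- s) Q.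
Proof.
elim: n P => [|n IH] P pP; first by rewrite ltNge hs_ge0.
move=> hn; have [mP|nmP] := pselect (M P).
  by exists [:: P]; [move=> Q; rewrite inE => /eqP ->|rewrite big_seq1].
have [Q [pQ QP nQP]] : exists Q, [/\ projections A Q, proj_le Q P & Q <> P].
  apply: contrapT => h; apply: nmP; split=> // Q pQ QP; apply: contrapT => nQP.
  by apply: h; exists Q.
have [AP P0 hP iP] := (projectionsP P).1 pP.
have [AQ Q0 hQ iQ] := (projectionsP Q).1 pQ.
have qp v : L Q (L P v) = L Q v by rewrite -L_comp QP.1.
have pq v : L P (L Q v) = L Q v by rewrite -L_comp QP.2.
have pPQ : projections A (P - Q).
  apply/projectionsP; split.
  - exact: subalgebraB.
  - by rewrite subr_eq0; apply/eqP => /esym.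
  - exact: adjointB.
  - by move=> u; rewrite !L_sub !L_subr iP iQ qp pq subrr subr0.
have e := hs_proj_sub hQ iQ qp.
have h1 : 1 <= hs Q by exact: hs_proj_ge1.
have h2 : 1 <= hs (P - Q).
  by have [_ ? ? ?] := (projectionsP _).1 pPQ; exact: hs_proj_ge1.
move: hn; rewrite -natr1 => hn.
have [|s hs1 es] := IH Q pQ; first by lra.
have [|t ht et] := IH _ pPQ; first by lra.
exists (s ++ t); last by rewrite big_cat/= -es -et addrC subrK.
by move=> S; rewrite mem_cat => /orP[/hs1|/ht].
Qed.

Lemma projection_sum_min P : projections A P ->
  exists2 s : seq (smooth_op R), (forall Q, Q \in s -> M Q) & P = \sum_(Q <- s) Q.
Proof.
move=> pP; apply: (projection_sum (n := (Num.truncn (hs P)).+1)) => //.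
by have /andP[] := truncn_itv (hs_ge0 P).
Qed.

(** [P] annihilates the sum over the remaining list, so removing [L P u] costs exactly [n2 (L P u)].
    Nonnegativity of the left side is Bessel's inequality. *)
Lemma bessel (r : seq (smooth_op R)) u : uniq r -> (forall Q, Q \in r -> M Q) ->
  n2 (u - \sum_(Q <- r) L Q u) = n2 u - \sum_(Q <- r) n2 (L Q u).
Proof.
elim: r => [|P r IH] /=; first by rewrite !big_nil !subr0.
move=> /andP[Pr ur] hM; rewrite !big_cons.
have mP : M P by apply: hM; rewrite inE eqxx.
have hM' Q : Q \in r -> M Q by move=> Qr; apply: hM; rewrite inE Qr orbT.
have [AP P0 hP iP] := min_projectionP mP.
have e : L P (u - \sum_(Q <- r) L Q u) = L P u.
  rewrite L_subr; suff -> : L P (\sum_(Q <- r) L Q u) = 0 by rewrite subr0.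
  rewrite big_seq; elim/big_ind: _ => [|v w hv hw|Q Qr]; first exact: L_zeror.
    by rewrite L_addr hv hw addr0.
  by apply: min_orth => //; [exact: hM'|move=> PQ; rewrite PQ Qr in Pr].
have := n2_proj_compl (u - \sum_(Q <- r) L Q u) hP iP.
by rewrite e IH// opprD [- L P u + _]addrC addrA => ->; ring.
Qed.

Lemma finite_large j n : finite_set [set P | M P /\ n.+1%:R^-1 < n2 (L P (l2_basis j))].
Proof.
apply: contrapT => /infinite_set_fset.
(* More than [n2 (l2_basis j) * n.+1] members, each contributing more than [1 / (n + 1)], would
   violate Bessel's inequality. *)
move=> /(_ (Num.bound (n2 (l2_basis j : l2 R) * n.+1%:R)))[B BM hB].
have hM Q : Q \in finmap.enum_fset B -> M Q by move=> /BM[].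
have := n2_ge0 (l2_basis j - \sum_(Q <- finmap.enum_fset B) L Q (l2_basis j)).
rewrite (bessel _ (finmap.fset_uniq B))// subr_ge0; apply/negP; rewrite -ltNge.
have n0 : 0 < n.+1%:R^-1 :> R by rewrite invr_gt0.
have sum_ge (r : seq (smooth_op R)) : (forall Q,
  Q \in r -> n.+1%:R^-1 <= n2 (L Q (l2_basis j))) ->
    (size r)%:R * n.+1%:R^-1 <= \sum_(Q <- r) n2 (L Q (l2_basis j)).
  elim: r => [|Q r IH] h; first by rewrite mul0r big_nil.
  rewrite big_cons/= -natr1 mulrDl mul1r addrC lerD ?h ?inE ?eqxx// IH// => S Sr.
  by rewrite h// inE Sr orbT.
apply: lt_le_trans (sum_ge (finmap.enum_fset B) _) => [|Q /BM[_ /ltW]//].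
rewrite ltr_pdivlMr//; apply: lt_le_trans (archi_boundP _) _.
  by rewrite mulr_ge0// n2_ge0.
by rewrite ler_nat.
Qed.

(** A nonzero operator is nonzero on some basis vector, so the countably many finite sets of
    [finite_large] cover [M]. *)
Lemma countable_min : countable M.
Proof.
apply: (@sub_countable _ _ _ (\bigcup_(p in [set: nat * nat])
    [set P | M P /\ p.2.+1%:R^-1 < n2 (L P (l2_basis p.1))])); last first.
  by apply: bigcup_countable => // p _; apply: finite_set_countable; exact: finite_large.
apply: subset_card_le => P mP; have [_ P0 _ _] := min_projectionP mP.
have [j hj] : exists j, L P (l2_basis j) <> 0.
  by apply: contrapT => /forallNP h; case/eqP: P0; apply: L_eq0 => j;
    exact: contrapT (h j).
have p0 : 0 < n2 (L P (l2_basis j)).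
  by rewrite lt_neqAle n2_ge0 andbT eq_sym; apply/negP => /eqP/n2_eq0.
exists (j, Num.bound (n2 (L P (l2_basis j)))^-1) => //; split=> //=.
rewrite invf_plt ?posrE//; apply: lt_trans (archi_boundP _) _.
  by rewrite invr_ge0 ltW.
by rewrite ltr_nat.
Qed.

(** * Consequences of the spectral projections *)

Section StarClosed.
Hypothesis clA : closed A.
Hypothesis starA : star_closed A.

Lemma starP x : A x -> exists2 y, A y & adjoint x y.
Proof. by move=> /starA[y Ay /adjointP]; exists y. Qed.

(** If [z = y P] is nonzero, its spectral projection lies below [P], hence is [P], and [z^2 = r P].
    With [c = sqrt r], the element [w = z + c P] satisfies [w^2 = 2 c w], so [w / (2 c)] is 0 or a
    projection below [P]; thus [z] is [- c P] or [c P]. *)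
Lemma min_eigen_herm P y : M P -> A y -> herm y -> exists t : R,
  forall u, L y (L P u) = t%:C *: L P u.
Proof.
move=> mP Ay hy; have [AP P0 hP iP] := min_projectionP mP.
pose z := y ** P; have Az : A z by exact: subalgebraM.
have hz : herm z by exact: hermM.
have zP u : L z (L P u) = L z u by rewrite !L_comp iP.
have Pz u : L P (L z u) = L z u by rewrite -(L_commute u Az AP) zP.
suff [t ht] : exists t : R, forall u, L z u = t%:C *: L P u.
  by exists t => u; rewrite -L_comp ht.
have [z0|z0] := eqVneq z 0; first by exists 0 => u; rewrite z0 L_zero scale0r.
have [r r0 [Q [AQ Q0 hQ iQ eQ]]] := spectral_projection subA clA Az hz z0.
have cr : r%:C != 0 by rewrite eq_complex/= eqxx andbT gt_eqF.
have QP : Q = P.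
  apply: min_eq => //; first by apply/projectionsP.
  (* [r Q = z^2 Q], and the range of [z] lies in that of [P]. *)
  move=> u; apply: (scalerI cr); rewrite -L_scaler -eQ.
  exact: Pz.
have zz u : L z (L z u) = r%:C *: L P u by have := eQ u; rewrite QP zP.
pose c := Num.sqrt r; have c0 : 0 < c by rewrite sqrtr_gt0.
have cc : c * c = r by rewrite -expr2 sqr_sqrtr// ltW.
pose w := z + c%:C *: P; have Aw : A w by apply: subalgebraD => //; exact: subalgebraZ.
have hw : herm w by exact: (adjointD hz (adjoint_scale c hP)).
have Lw u : L w u = L z u + c%:C *: L P u by rewrite L_add L_scale.
have ww u : L w (L w u) = (2 * c)%:C *: L w u.
  rewrite !Lw !L_addr !L_scaler zz zP Pz iP !scalerDr !scalerA -!rmorphM cc.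
  rewrite mulrDl mul1r rmorphD !scalerDl mulrDl cc rmorphD !scalerDl.
  by rewrite [X in X + _ = _]addrC addrACA.
have [w0|w0] := eqVneq w 0.
  exists (- c) => u; have := Lw u; rewrite w0 L_zero => /esym/eqP.
  by rewrite addr_eq0 rmorphN scaleNr => /eqP.
have c20 : 2 * c != 0 by rewrite mulf_neq0// gt_eqF.
have wP : (2 * c)^-1%:C *: w = P.
  apply: min_eq => //; last by move=> u; rewrite L_scale L_scaler Lw L_addr L_scaler Pz
    iP.
  apply/projectionsP; split.
  - exact: subalgebraZ.
  - by rewrite scaler_eq0 negb_or w0 andbT eq_complex/= eqxx andbT invr_eq0.
  - exact: (adjoint_scale _ hw).
  - move=> u; rewrite !L_scale L_scaler ww; congr (_ *: _).
    by rewrite scalerA -rmorphM mulVf// rmorph1 scale1r.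
exists c => u; have : L w u = (2 * c)%:C *: L P u.
  by rewrite -{1}wP L_scale scalerA -rmorphM mulfV// rmorph1 scale1r.
rewrite Lw mulrDl mul1r rmorphD scalerDl; exact: addIr.
Qed.

Lemma min_eigen P x : M P -> A x -> exists mu : R[i], P ** x = mu *: P.
Proof.
move=> mP Ax; have [AP P0 hP iP] := min_projectionP mP; have [y Ay xy] := starP Ax.
have hp : herm (x + y) by move=> u v; rewrite [in RHS]addrC (adjointD xy (adjointC xy)).
have hm : herm (ci *: (y - x)).
  have := adjoint_i (adjointB (adjointC xy) xy).
  by rewrite scaleNr -scalerN opprB.
have [t ht] := min_eigen_herm mP (subalgebraD Ax Ay) hp.
have [t' ht'] := min_eigen_herm mP (subalgebraZ ci (subalgebraB Ay Ax)) hm.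
(* [x + y] and [i (y - x)] are twice the real and imaginary parts of [x]; both are self-adjoint and
   lie in [A]. *)
have e : x = 2^-1 *: (x + y) + (2^-1 * ci) *: (ci *: (y - x)).
  rewrite scalerA -mulrA (_ : ci * ci = -1); last first.
    by apply/eqP; rewrite eq_complex/=; apply/andP; split; apply/eqP; ring.
  rewrite mulrN1 scaleNr -scalerN opprB -scalerDr addrACA subrr addr0 -mulr2n -[x *+
    2]scaler_nat.
  by rewrite scalerA mulVf ?scale1r// pnatr_eq0.
exists (2^-1 * t%:C + 2^-1 * ci * t'%:C); apply: L_inj => u.
rewrite L_comp (L_commute _ AP Ax) L_scale {1}e L_add !(L_scale 2^-1) ht (L_scale (2^-1
  * ci)) ht'.
by rewrite !scalerA -scalerDl.
Qed.

(** Otherwise [d' ** d], with [d'] the adjoint, has a nonzero spectral projection [Q]. Minimal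
    projections commute with [d'] and annihilate [d], hence annihilate [Q]; but [Q] is a sum of
    minimal projections. *)
Lemma min_kernel d : A d -> (forall P u, M P -> L P (L d u) = 0) -> d = 0.
Proof.
move=> Ad hd; apply: contrapT => d0; have [d' Ad' dd'] := starP Ad.
pose w := d' ** d; have Aw : A w by exact: subalgebraM.
have hw : herm w by exact: adjoint_herm.
have w0 : w != 0.
  apply/eqP => w0; apply: d0; apply: L_inj => u; rewrite L_zero; apply: n2_eq0.
  by rewrite /n2 dd' -L_comp -/w w0 L_zero rinnerC rinner0l.
have [r r0 [Q [AQ Q0 hQ iQ eQ]]] := spectral_projection subA clA Aw hw w0.
have cr : r%:C != 0 by rewrite eq_complex/= eqxx andbT gt_eqF.
have PQ P u : M P -> L P (L Q u) = 0.
  move=> mP; have [AP _ _ _] := min_projectionP mP; apply: (scalerI cr).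
  by rewrite -L_scaler -eQ L_comp (L_commute _ AP Ad') hd// L_zeror scaler0.
have [s hs es] : exists2 s : seq (smooth_op R), (forall Q, Q \in s -> M Q) &
    Q = \sum_(Q <- s) Q by apply: projection_sum_min; exact/projectionsP.
case/eqP: Q0; apply: L_inj => u; rewrite L_zero -iQ {1}es L_sum big_seq big1// => P Ps.
by rewrite PQ//; exact: hs.
Qed.

End StarClosed.

End CommutativeAlgebra.

(** * Expansion in minimal projections *)

Section Expansion.
Context {R : realType}.
Local Open Scope complex_scope.
Notation L := l2_restr.
Notation "x ** y" := (smooth_op_comp x y) (at level 40, left associativity).
Implicit Types (x y d P Q : smooth_op R) (u v : l2 R).
Variable A : set (smooth_op R).
Hypothesis subA : subalgebra A.
Hypothesis comA : commutative_set A.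
Hypothesis clA : closed A.
Hypothesis starA : star_closed A.
Notation M := (minimal_projections A).

Lemma L_min_sum n (e : 'I_n -> smooth_op R) (mu : 'I_n -> R[i]) k u :
  (forall i, M (e i)) -> injective e ->
  L (e k) (L (\sum_i mu i *: e i) u) = mu k *: L (e k) u.
Proof.
move=> he ie; have [_ _ _ ik] := min_projectionP (he k).
rewrite L_sum (bigD1 k)//= L_addr L_scale L_scaler ik -[RHS]addr0; congr (_ + _).
elim/big_ind: _ => [|v w hv hw|i ki]; first exact: L_zeror.
  by rewrite L_addr hv hw addr0.
rewrite L_scale L_scaler (min_orth subA comA) ?scaler0// => /ie/eqP.
by rewrite eq_sym (negbTE ki).
Qed.

Section Sequence.
Variable e : nat -> smooth_op R.
Hypothesis he : forall n, M (e n).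
Hypothesis ie : injective e.
Hypothesis se : forall P, M P -> exists k, e k = P.

Let E n : smooth_op R := \sum_(k < n) e k.

Let ES n : E n.+1 = E n + e n. Proof. exact: big_ord_recr. Qed.

Let AE n : A (E n).
Proof.
elim: n => [|n IH]; first by rewrite /E big_ord0; exact: subalgebra0.
by rewrite ES; apply: subalgebraD => //; have [] := min_projectionP (he n).
Qed.

Let hE n : herm (E n).
Proof.
elim: n => [|n IH]; first by rewrite /E big_ord0 => u v;
  rewrite !L_zero rinner0l rinnerC rinner0l.
by rewrite ES; apply: adjointD => //; have [] := min_projectionP (he n).
Qed.

Let eE k n u : L (e k) (L (E n) u) = if (k < n)%N then L (e k) u else 0.
Proof.
elim: n => [|n IH]; first by rewrite /E big_ord0 L_zero L_zeror.
rewrite ES L_add L_addr IH ltnS; have [kn|nk|->] := ltngtP k n.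
- by rewrite (min_orth subA comA) ?addr0// => /ie kn'; rewrite kn' ltnn in kn.
- by rewrite (min_orth subA comA) ?addr0// => /ie kn'; rewrite kn' ltnn in nk.
- by have [_ _ _ ->] := min_projectionP (he n); rewrite add0r.
Qed.

Let EE n m u : (n <= m)%N -> L (E n) (L (E m) u) = L (E n) u.
Proof.
move=> nm; have LE k v : L (E k) v = \sum_(i < k) L (e i) v by exact: L_sum.
rewrite [LHS]LE [RHS]LE; apply: eq_bigr => k _.
by rewrite eE (leq_trans (ltn_ord k) nm).
Qed.

Let iE n : idem (E n). Proof. by move=> u; exact: EE. Qed.

Lemma expansion_op_cvg x : A x -> op_cvg (fun n => E n ** x) x.
Proof.
move=> Ax; have [y Ay xy] := starP starA Ax.
have nE n u : n2 (L (E n) u) <= n2 u.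
  by have := n2_ge0 (u - L (E n) u); rewrite n2_proj_compl// subr_ge0.
have cE n u : n2 (u - L (E n) u) <= n2 u.
  by rewrite n2_proj_compl// gerBl n2_ge0.
pose T n := x - E n ** x; pose Y n := y - E n ** y.
(* Commutativity puts the adjoint of [E n ** x] into the form [E n ** y], again with [E n] on the
   left. *)
have TY n : adjoint (T n) (Y n).
  by apply: adjointB => //; rewrite (comA (AE n) Ay); exact: (adjointM (hE n) xy).
(* [1 - E n] is a contraction acting from the left, so column bounds hold uniformly in [n]. *)
have colleT q z C : column_le q z C -> forall n, column_le q (z - E n ** z) C.
  move=> hz n k; apply: le_trans (hz k); apply: ler_sum => j _.
  by rewrite ler_wpM2l ?s_weight_ge0// L_sub L_comp.
(* As the [E n] are nested, [hs (T n - T m)] is an increment of [G], which increases and stays below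
   [hs x]. *)
pose G n := hs (E n ** x).
have hipE n m : (n <= m)%N -> hs_inner (E n ** x) (E m ** x) = G n.
  move=> nm; rewrite /G /hs !(hs_inner_adjoint _ _ (hE n)); congr hs_inner.
  by apply: L_inj => u; rewrite !L_comp EE// iE.
have dG n m : (n <= m)%N -> hs (T n - T m) = G m - G n.
  move=> nm; rewrite (_ : T n - T m = E m ** x - E n ** x).
    by rewrite hsB hs_innerC hipE// /G; ring.
  by rewrite /T opprB addrC addrA subrK addrC.
have ndG : nondecreasing_seq G.
  by move=> n m nm; rewrite -subr_ge0 -dG ?hs_ge0.
have cG : cvgn G.
  apply: nondecreasing_is_cvgn => //; exists (hs x) => _ [n _ <-].
  apply/hsP => k; have /(_ k) h := (hsP x (hs x)).2 (lexx _).
  by apply: le_trans h; apply: ler_sum => j _; rewrite ler_wpM2l ?s_weight_ge0// L_comp.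
have TC : op_cauchy T.
  apply: (hs_op_cauchy TY) => [q|eps e0].
    have [C hC] := column_le_exists q x; have [D hD] := column_le_exists q y.
    have C0 := column_le_ge0 hC; have D0 := column_le_ge0 hD.
    exists (C + D) => n; split=> k.
      by apply: le_trans (colleT _ _ _ hC n k) _; rewrite lerDl.
    by apply: le_trans (colleT _ _ _ hD n k) _; rewrite lerDr.
  have e2 : 0 < eps / 2 by rewrite divr_gt0.
  move/cvgrPdist_lt : (cG) => /(_ _ e2)[N _ hN]; exists N => n m Nn Nm.
  have hsC : hs (T n - T m) = hs (T m - T n) by rewrite !hsB (hs_innerC (T n) (T m));
    ring.
  have h1 := hN n Nn; have h2 := hN m Nm; rewrite /= in h1 h2.
  move: h1 h2; rewrite !ltr_norml => /andP[? ?] /andP[? ?].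
  by have [nm|/ltnW mn] := leqP n m; [rewrite dG//|rewrite hsC dG//]; lra.
have [d Td] := op_cauchy_cvg TC.
have Ad : A d.
  by apply: (closed_op_cvg clA _ Td) => n; apply: subalgebraB => //; exact: subalgebraM.
have d0 : d = 0.
  apply: (min_kernel subA comA clA starA Ad) => P u /se[k <-].
  (* [e k] annihilates [T n] as soon as [n > k]; the shift by [k.+1] skips the earlier terms. *)
  apply: (l2_cvg_unique (l2_cvg_op (e k) (l2_cvg_shift k.+1 (op_cvg_l2_cvg u Td)))).
  have ek n : L (e k) (L (T (k.+1 + n)%N) u) = 0.
    by rewrite /T L_sub L_comp L_subr eE leq_addr subrr.
  by under eq_fun do rewrite ek; exact: l2_cvg_cst.
(* Convergence of [T n] to 0 is the claim up to a sign. *)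
move=> q eps e0; have [N hN] := Td q _ e0; exists N => n /hN.
rewrite d0 subr0 => h xi C hC; have := sqleZ (-1) (h xi C hC).
rewrite {1}/re_inner/= oppr0 mulr0 addr0 mulrNN !mul1r.
rewrite (_ : _ *: _ = s_val ((E n ** x - x) xi))//.
rewrite scaleN1r.
transitivity (- (s_val (x xi) - s_val (E n (s_to_sdual (x xi))))); first by [].
by rewrite opprB.
Qed.

Lemma infinite_basis : infinite_schauder_basis A e.
Proof.
split=> [n|x Ax]; first by have [] := min_projectionP (he n).
have /choice[mu hmu] : forall k, exists mu : R[i], e k ** x = mu *: e k.
  by move=> k; exact: (min_eigen subA comA clA starA (he k) Ax).
have ek0 k : e k != 0 by have [] := min_projectionP (he k).
exists mu; split.
  rewrite (_ : series _ = fun n => E n ** x).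
    exact/op_cvg_cvg/expansion_op_cvg.
  apply/funext => n; apply: L_inj => u.
  rewrite /series/= big_mkord L_comp /E !L_sum; apply: eq_bigr => k _.
  by rewrite -hmu L_comp.
move=> nu /cvg_op_cvg hnu; apply/funext => k; apply/eqP.
suff : (mu k - nu k) *: e k == 0 by rewrite scaler_eq0 (negbTE (ek0 k)) orbF subr_eq0.
apply/eqP/L_inj => u; rewrite L_zero L_scale scalerBl; apply/eqP; rewrite subr_eq0;
  apply/eqP.
(* Applying [e k] to the partial sums beyond [k] leaves the constant value [nu k *: L (e k) u], so
   the limit determines the coefficient. *)
rewrite -L_scale -hmu L_comp; apply: (l2_cvg_unique (l2_cvg_op (e k) (l2_cvg_shift k.+1
  (op_cvg_l2_cvg u hnu)))).
have h n : L (e k) (L (series (fun n => nu n *: e n) (k.+1 + n)%N) u) = nu k *: L (e k) u.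
  rewrite /series/= big_mkord.
  have kn : (k < k.+1 + n)%N by rewrite leq_addr.
  apply: (@L_min_sum _ (fun i : 'I_(k.+1 + n) => e i) (fun i : 'I_(k.+1 + n) =>
    nu i) (Ordinal kn)) => //.
  by move=> i j /ie ij; exact: val_inj.
by under eq_fun do rewrite h; exact: l2_cvg_cst.
Qed.

End Sequence.

Lemma finite_basis n (e : 'I_n -> smooth_op R) : (forall i, M (e i)) ->
  injective e -> (forall P, M P -> exists i, e i = P) -> finite_schauder_basis A e.
Proof.
move=> he ie se; split=> [i|x Ax]; first by have [] := min_projectionP (he i).
have /choice[mu hmu] : forall k, exists mu : R[i], e k ** x = mu *: e k.
  by move=> k; exact: (min_eigen subA comA clA starA (he k) Ax).
have ek0 k : e k != 0 by have [] := min_projectionP (he k).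
exists mu; split.
  apply/eqP; rewrite -subr_eq0; apply/eqP.
  (* The finite sum needs no limit: every minimal projection annihilates its difference from [x]. *)
  apply: (min_kernel subA comA clA starA).
    apply: subalgebraB => //; elim/big_ind: _ => [|a b Aa Ab|i _];
      first exact: subalgebra0.
      exact: subalgebraD.
    by apply: subalgebraZ => //; have [] := min_projectionP (he i).
  move=> P u /se[k <-]; rewrite L_sub L_subr L_min_sum// -L_comp hmu L_scale subrr//.
move=> nu ex; apply/funext => k; apply/eqP.
suff : (mu k - nu k) *: e k == 0 by rewrite scaler_eq0 (negbTE (ek0 k)) orbF subr_eq0.
apply/eqP/L_inj => u; rewrite L_zero L_scale scalerBl; apply/eqP; rewrite subr_eq0;
  apply/eqP.
by rewrite -L_scale -hmu L_comp {1}ex L_min_sum.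
Qed.

End Expansion.

Theorem lemma4p4 (R : realType) (A : set (smooth_op R))
    (subA : subalgebra A) (comA : commutative_set A) :
  [/\ countable (minimal_projections A),
      forall P Q, minimal_projections A P -> minimal_projections A Q ->
        P <> Q -> smooth_op_comp P Q = 0 &
      forall P, projections A P ->
        exists (m : nat) (P' : 'I_m -> smooth_op R),
          (forall i, minimal_projections A (P' i)) /\ P = \sum_(i < m) P' i] /\
  (closed A -> star_closed A -> schauder_basis A (minimal_projections A)).
Proof.
split; [split|].
- exact: countable_min.
- by move=> P Q mP mQ PQ; apply: L_inj => u; rewrite L_comp L_zero (min_orth subA comA).
- move=> P /(projection_sum_min subA)[s hs ->].
  (* The default value 0 of [nth] is never reached, as the index stays below [size s]. *)
  exists (size s), (fun i => s`_i); split=> [i|]; first by apply: hs; rewrite mem_nth.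
  by rewrite (big_nth 0) big_mkord.
move=> clA starA; split; first exact: countable_min.
- move=> n e [he ie se]; apply: finite_basis => //.
  + by move=> i; exact: he.
  + by move=> i j; apply: ie; rewrite inE.
  + by move=> P /se[i _ <-]; exists i.
- move=> e [he ie se]; apply: infinite_basis => //.
  + by move=> i; exact: he.
  + by move=> i j; apply: ie; rewrite inE.
  + by move=> P /se[i _ <-]; exists i.
Qed.
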